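(* $$\lim_{n\to\infty}\frac{t(4,n)}{r(4,n)}=0.$$
   Context: All graphs are finite and simple. In a graph $G=(V,E)$, a set $X\subseteq V$ is irredundant if every vertex $x\in X$ is either isolated in the induced subgraph $G[X]$, or has a private neighbor, i.e. a vertex $y\in V\setminus X$ adjacent to $x$ and to no other vertex of $X$. For a red-blue coloring of the edges of $K_N$, the blue (resp. red) subgraph is the spanning subgraph formed by the blue (resp. red) edges. The mixed Ramsey number $t(m,n)$ is the smallest $N$ such that every red-blue coloring of the edges of $K_N$ has an $m$-element irredundant set in the blue subgraph or an $n$-element independent set in the red subgraph. The Ramsey number $r(m,n)$ is the smallest $N$ such that every red-blue coloring of the edges of $K_N$ has an $m$-element independent set in the blue subgraph (equivalently, a red $K_m$) or an $n$-element independent set in the red subgraph (equivalently, a blue $K_n$). *)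

(* Defs.v *)
From mathcomp Require Import all_boot.

Set Implicit Arguments.
Unset Strict Implicit.
Unset Printing Implicit Defensive.

Section Graphs.

(* e is meant to be the adjacency relation of a simple graph, i.e. symmetric
   and irreflexive; see blue_sym, blue_irr, red_sym and red_irr below. *)
Variables (T : finType) (e : rel T).
Implicit Types (x y : T) (X : {set T}).

Definition independent X : bool :=
  [forall x in X, forall y in X, ~~ e x y].

Definition isolated_in X x : bool := [forall y in X, ~~ e x y].

Definition private_neighbor X x y : bool :=
  [&& y \notin X, e x y & [forall z in X, e z y ==> (z == x)]].

Definition irredundant X : bool :=
  [forall x in X, isolated_in X x || [exists y, private_neighbor X x y]].

Lemma independent_irredundant X : independent X -> irredundant X.
Proof.
move=> /forall_inP indX; apply/forall_inP => x xX.
by rewrite /isolated_in indX.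
Qed.

End Graphs.

(* A coloring of the edges of K_N: the color of the edge xy is c [set x; y],
   with true for blue and false for red. The values of c on sets that are not
   pairs are never used, since the subgraphs below require x != y. *)
Definition coloring (N : nat) := {ffun {set 'I_N} -> bool}.

Definition blue N (c : coloring N) : rel 'I_N :=
  fun x y => (x != y) && c [set x; y].

Definition red N (c : coloring N) : rel 'I_N :=
  fun x y => (x != y) && ~~ c [set x; y].

Definition mixed_ramsey_prop (m n N : nat) : bool :=
  [forall c : coloring N,
    [exists X : {set 'I_N}, (#|X| == m) && irredundant (blue c) X]
    || [exists X : {set 'I_N}, (#|X| == n) && independent (red c) X]].

Definition ramsey_prop (m n N : nat) : bool :=
  [forall c : coloring N,
    [exists X : {set 'I_N}, (#|X| == m) && independent (blue c) X]
    || [exists X : {set 'I_N}, (#|X| == n) && independent (red c) X]].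

Lemma blue_sym N (c : coloring N) : symmetric (blue c).
Proof. by move=> x y; rewrite /blue eq_sym setUC. Qed.

Lemma blue_irr N (c : coloring N) : irreflexive (blue c).
Proof. by move=> x; rewrite /blue eqxx. Qed.

Lemma red_sym N (c : coloring N) : symmetric (red c).
Proof. by move=> x y; rewrite /red eq_sym setUC. Qed.

Lemma red_irr N (c : coloring N) : irreflexive (red c).
Proof. by move=> x; rewrite /red eqxx. Qed.

Lemma redE N (c : coloring N) x y : red c x y = (x != y) && ~~ blue c x y.
Proof. by rewrite /red /blue; case: (x != y). Qed.

Lemma independentU1 (T : finType) (e : rel T) v X :
  symmetric e -> irreflexive e -> independent e X ->
  {in X, forall y, ~~ e v y} -> independent e (v |: X).
Proof.
move=> es ei /forall_inP iX vX; apply/forall_inP => x /setU1P[->|xX];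
  apply/forall_inP => y /setU1P[->|yX]; rewrite ?ei ?vX //.
- by rewrite es vX.
- exact: (forall_inP (iX x xX)).
Qed.

Lemma ramsey_subset (m n : nat) : exists N, forall M (c : coloring M) (A : {set 'I_M}),
  N <= #|A| ->
  (exists X : {set 'I_M}, [/\ X \subset A, #|X| = m & independent (blue c) X]) \/
  (exists X : {set 'I_M}, [/\ X \subset A, #|X| = n & independent (red c) X]).
Proof.
have ind0 (T : finType) (e : rel T) : independent e set0.
  by apply/forall_inP => x; rewrite inE.
elim: m n => [|m IHm] n.
  by exists 0 => M c A _; left; exists set0; rewrite sub0set cards0.
elim: n => [|n [N2 IHn]].
  by exists 0 => M c A _; right; exists set0; rewrite sub0set cards0.
have [N1 {}IHm] := IHm n.+1.
exists (N1 + N2).+1 => M c A leA.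
have /card_gt0P[v vA] : 0 < #|A| by apply: leq_trans leA.
pose A1 := [set y in A | red c v y]; pose A2 := [set y in A | blue c v y].
have sA : A \subset v |: (A1 :|: A2).
  apply/subsetP => y yA; rewrite !inE yA /= /red /blue.
  by case: eqVneq => //= _; rewrite orNb.
have : N1 + N2 <= #|A1| + #|A2|.
  rewrite -ltnS; apply: leq_trans leA _; apply: leq_trans (subset_leq_card sA) _.
  rewrite cardsU1 -[in leqRHS]add1n; apply: leq_add; first by case: (_ \notin _).
  by rewrite cardsU leq_subr.
have s1 : A1 \subset A by apply/subsetP => y; rewrite inE => /andP[].
have s2 : A2 \subset A by apply/subsetP => y; rewrite inE => /andP[].
case: (leqP N1 #|A1|) => [le1 _|lt1 le12].
  case: (IHm M c A1 le1) => -[X [sX cX iX]]; last first.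
    by right; exists X; rewrite (subset_trans sX s1).
  have nvX : {in X, forall y, (v != y) && ~~ blue c v y}.
    by move=> y /(subsetP sX); rewrite inE redE => /andP[].
  left; exists (v |: X); split.
  - by rewrite subUset sub1set vA (subset_trans sX s1).
  - rewrite cardsU1 cX; case: (boolP (v \in X)) => // /nvX.
    by rewrite eqxx.
  - apply: independentU1 => //; [exact: blue_sym|exact: blue_irr|].
    by move=> y /nvX /andP[].
have le2 : N2 <= #|A2|.
  by rewrite -(leq_add2l N1) (leq_trans le12) // leq_add2r ltnW.
case: (IHn M c A2 le2) => -[X [sX cX iX]].
  by left; exists X; rewrite (subset_trans sX s2).
have nvX : {in X, forall y, blue c v y}.
  by move=> y /(subsetP sX); rewrite inE => /andP[].
right; exists (v |: X); split.
- by rewrite subUset sub1set vA (subset_trans sX s2).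
- rewrite cardsU1 cX; case: (boolP (v \in X)) => // /nvX.
  by rewrite blue_irr.
- apply: independentU1 => //; [exact: red_sym|exact: red_irr|].
  by move=> y /nvX; rewrite redE => ->; rewrite andbF.
Qed.

Lemma ramsey_ex (m n : nat) : exists N, ramsey_prop m n N.
Proof.
have [N HN] := ramsey_subset m n; exists N; apply/forallP => c.
have le : N <= #|[set: 'I_N]| by rewrite cardsT card_ord.
case: (HN N c _ le) => -[X [_ /eqP cX iX]]; apply/orP; [left|right];
  by apply/existsP; exists X; rewrite cX iX.
Qed.

Lemma ramsey_mixed_ramsey (m n N : nat) :
  ramsey_prop m n N -> mixed_ramsey_prop m n N.
Proof.
move=> /forallP rN; apply/forallP => c; have /orP[] := rN c; last first.
  by move=> ->; rewrite orbT.
case/existsP => X /andP[cX iX]; apply/orP; left; apply/existsP; exists X.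
by rewrite cX independent_irredundant.
Qed.

Lemma mixed_ramsey_ex (m n : nat) : exists N, mixed_ramsey_prop m n N.
Proof.
have [N rN] := ramsey_ex m n; exists N; exact: ramsey_mixed_ramsey.
Qed.

Definition mixed_ramsey (m n : nat) : nat := ex_minn (mixed_ramsey_ex m n).

Definition ramsey (m n : nat) : nat := ex_minn (ramsey_ex m n).

(* Main.v *)
Require Import Defs.
From mathcomp Require Import all_boot all_order all_algebra all_field.
From mathcomp Require Import zify ring lra.

(* The two Ramsey numbers have different polynomial orders.

   Upper bound, t(4,n) = O(n^(8/3)). If no 4-set is irredundant in the blue
   graph, then every red neighbourhood A is triangle-free and any two disjoint
   edges joining the neighbourhoods of two nonadjacent vertices of A are linked
   by a third edge (a hexagon whose opposite vertices are nonadjacent would give,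
   with the centre, an irredundant 4-set). Partition A into the neighbourhoods
   of a maximal independent set S of A. Between two classes the red graph has
   nested neighbourhoods, so e edges can be covered by e / tau + tau vertices.
   Colouring S with about n^(2/3) colours so that few pairs are monochromatic
   and deleting the covers inside each colour leaves independent sets, whence
   |A| = O(n^(5/3)). A graph of maximum degree D on N vertices has an
   independent set of size N / (D + 1).

   Lower bound, r(4,n) >= n^(3-o(1)) (Mattheus and Verstraete). The graph whose
   vertices are the secants of the Hermitian curve x^(q+1) = y^q + y over the
   field with q^2 elements, two being adjacent when they meet on the curve, is a
   union of cliques, one for each point. By O'Nan's lemma every K_4 contains
   three concurrent secants, so replacing each clique by a random complete bipartite
   graph makes it K_4-free. The result has an edge density about 1/q on every
   set of 8 q^2 vertices, so the Kleitman-Winston argument bounds the number of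
   independent sets of size t = 512 q k^2, where q = 2^k, and a random set of q^3/16
   vertices contains none. *)

Set Implicit Arguments.
Unset Strict Implicit.
Unset Printing Implicit Defensive.

(** * Upper bound for the mixed Ramsey number *)

(** Overwriting [f a] by an arbitrary colour is injective on pairs, since the lost value can be read
    off at b. So a uniform colouring identifies a and b with probability at most 1/q. *)
Lemma card_ffun_eq2 (T : finType) (q : nat) (a b : T) : a != b ->
  q * #|[set f : {ffun T -> 'I_q} | f a == f b]| <= q ^ #|T|.
Proof.
move=> ab; set D := [set f | _].
have -> : q * #|D| = #|setX [set: 'I_q] D| by rewrite cardsX cardsT card_ord.
have -> : q ^ #|T| = #|{ffun T -> 'I_q}| by rewrite card_ffun card_ord.
pose g (u : 'I_q * {ffun T -> 'I_q}) := [ffun x => if x == a then u.1 else u.2 x].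
rewrite -(@card_in_imset _ _ g); first exact: max_card.
move=> [c f] [c' f']; rewrite !inE /= => /eqP fab /eqP fab' /ffunP gg.
have cc : c = c' by have := gg a; rewrite !ffunE eqxx.
congr pair => //; apply/ffunP => x; have := gg x; rewrite !ffunE /=.
case: eqVneq => // -> _; rewrite fab fab'.
by have := gg b; rewrite !ffunE eq_sym (negPf ab).
Qed.

(** First moment: under a uniform colouring the expected monochromatic weight is at most 1/q of the
    total, so some colouring does as well. *)
Lemma coloring_few_mono (T : finType) (S : {set T}) (w : T -> T -> nat) q :
  0 < q -> exists f : {ffun T -> 'I_q},
  q * (\sum_(u in setX S S | (u.1 != u.2) && (f u.1 == f u.2)) w u.1 u.2)
    <= \sum_(u in setX S S) w u.1 u.2.
Proof.
move=> q0; pose m := \sum_(u in setX S S) w u.1 u.2.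
pose F (f : {ffun T -> 'I_q}) := \sum_(u in setX S S | (u.1 != u.2) && (f u.1 == f u.2)) w u.1 u.2.
apply/existsP; apply: contraT; rewrite negb_exists => /forallP H.
have : \sum_(f : {ffun T -> 'I_q}) q * F f <= q ^ #|T| * m.
  rewrite -big_distrr /= /F.
  under eq_bigr do rewrite big_mkcondr /=.
  rewrite exchange_big /= !big_distrr /=; apply: leq_sum => u _.
  have [uu|uu] := eqVneq u.1 u.2; first by rewrite big1 ?muln0.
  rewrite -big_mkcond /= sum_nat_const mulnA leq_mul2r; apply/orP; right.
  by rewrite -[X in q * X]cardsE card_ffun_eq2.
have : \sum_(f : {ffun T -> 'I_q}) m.+1 <= \sum_(f : {ffun T -> 'I_q}) q * F f.
  by apply: leq_sum => f _; rewrite ltnNge H.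
rewrite sum_nat_const card_ffun card_ord => h1 h2.
have := leq_trans h1 h2; rewrite leq_mul2l expn_eq0 ltnn orbF.
by case: q q0 {H F h1 h2}.
Qed.

(** * Independent sets and the hexagon condition *)

Section Graph.
Variables (T : finType) (e : rel T).
Hypotheses (e_sym : symmetric e) (e_irr : irreflexive e).

Lemma independentP (X : {set T}) :
  reflect {in X &, forall x y, ~~ e x y} (independent e X).
Proof.
apply: (iffP forall_inP) => [H x y xX yX|H x xX].
  by have /forall_inP := H x xX; apply.
by apply/forall_inP => y yX; apply: H.
Qed.

Lemma independent_sub (X Y : {set T}) :
  X \subset Y -> independent e Y -> independent e X.
Proof.
move=> /subsetP XY /independentP iY; apply/independentP => x y xX yX.
by apply: iY; apply: XY.
Qed.

Lemma independent_subset_card (n : nat) (X : {set T}) :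
  independent e X -> n <= #|X| ->
  exists Y : {set T}, [/\ Y \subset X, #|Y| = n & independent e Y].
Proof.
move=> iX; rewrite -bin_gt0 -cards_draws => /card_gt0P[Y].
rewrite inE => /andP[YX /eqP cY]; exists Y; split => //.
exact: independent_sub iX.
Qed.

Lemma maximal_independent (A : {set T}) : exists S : {set T},
  [/\ S \subset A, independent e S &
      forall y, y \in A -> y \notin S -> exists2 a, a \in S & e a y].
Proof.
pose P (S : {set T}) := (S \subset A) && independent e S.
have P0 : P set0 by rewrite /P sub0set; apply/independentP => x; rewrite inE.
have [S /maxsetP[/andP[SA iS] maxS] _] := maxset_exists P0.
exists S; split => // y yA yS.
apply/exists_inP; apply: contraNT yS; rewrite negb_exists_in => /forall_inP H.
suff -> : S = y |: S by rewrite setU11.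
rewrite -[LHS](maxS (y |: S)) ?subsetUr //.
rewrite /P subUset sub1set yA SA /=; apply: independentU1 => // z zS.
by rewrite e_sym H.
Qed.

Lemma card_fibers (U I : finType) (f : U -> I) (X : {set U}) (S : {set I}) :
  {in X, forall x, f x \in S} ->
  #|X| = \sum_(a in S) #|[set z in X | f z == a]|.
Proof.
move=> fS; rewrite -sum1_card (partition_big f (mem S)) //=.
by apply: eq_bigr => a _; rewrite -sum1_card; apply: eq_bigl => x; rewrite inE.
Qed.

Lemma card_bigcup_leq (U I : finType) (P : pred I) (F : I -> {set U}) :
  #|\bigcup_(i | P i) F i| <= \sum_(i | P i) #|F i|.
Proof.
elim/big_rec2: _ => [|i m X _ le]; first by rewrite cards0.
by rewrite (leq_trans (leq_card_setU _ _)) // leq_add2l.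
Qed.

(** Here A stands for a red neighbourhood and h for about n^(1/3), so the bound has order
    n^(5/3). *)
Lemma hexagon_card_bound (A : {set T}) (n h : nat) :
  n <= h ^ 3 ->
  {in A & &, forall x y z, e x y -> e y z -> ~~ e x z} ->
  (forall a1 b1 b2 a2 b3 b4,
     {subset [:: a1; b1; b2; a2; b3; b4] <= A} ->
     path e a1 [:: b1; b2; a2; b3; b4; a1] ->
     [|| e a1 a2, e b1 b3 | e b2 b4]) ->
  (forall X : {set T}, X \subset A -> independent e X -> #|X| < n) ->
  #|A| <= 12 * n * h ^ 2.
Proof.
move=> nh tri hex alpha.
have [S [SA iS domS]] := maximal_independent A.
have nbr_lt y : y \in A -> #|[set z in A | e y z]| < n.
  move=> yA; apply: alpha; first by apply/subsetP => z; rewrite inE => /andP[].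
  apply/independentP => z z'; rewrite !inE => /andP[zA yz] /andP[zA' yz'].
  by apply: (tri z y z') => //; rewrite e_sym.
pose W := A :\: S.
have WA y : y \in W -> y \in A by rewrite inE => /andP[].
(* [par] chooses a neighbour in S; by maximality of S the default never occurs on W. The classes
   [M a] are its fibres. *)
pose par y := odflt y [pick a in S | e a y].
have parP y : y \in W -> (par y \in S) * (e (par y) y).
  rewrite inE => /andP[yS yA]; rewrite /par; case: pickP => [a /andP[]//|].
  have [a aS ay] := domS y yA yS.
  by move=> /(_ a) /=; rewrite aS ay.
pose M a := [set y in W | par y == a].
have MW a y : y \in M a -> y \in W by rewrite inE => /andP[].
have MA a y : y \in M a -> y \in A by move/MW/WA.
have Mpar a y : y \in M a -> e a y.
  by rewrite inE => /andP[/parP[_ +] /eqP <-].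
pose d a y := #|[set z in M a | e y z]|.
pose E a a' := \sum_(y in M a) d a' y.
(* Degree threshold and number of colours: q tau = 8 h^3 is large enough to absorb the term |W| n in
   [key]. *)
pose tau := 8 * h; pose q := h ^ 2.
case: (posnP n) => [n0|n0].
  have i0 : independent e set0 by apply/independentP => x; rewrite inE.
  by have := alpha set0 (sub0set _) i0; rewrite n0.
have h0 : 0 < h by case: h nh {tau q} => //; rewrite leqNgt n0.
have q0 : 0 < q by rewrite expn_gt0 h0.
(* Every edge between [M a] and [M a'] starts in [Hi a a'] or ends in [Lo a a'], so these two sets
   form a vertex cover. *)
pose Hi a a' := [set y in M a | tau <= d a' y].
pose Lo a a' := [set z in M a' | [exists y in M a, e y z && (d a' y < tau)]].
have card_Hi a a' : tau * #|Hi a a'| <= E a a'.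
  rewrite mulnC -sum_nat_const /E [leqRHS](bigID (fun y => tau <= d a' y)) /=.
  rewrite -[leqLHS]addn0 leq_add // big_mkcond [leqRHS]big_mkcond /=.
  by apply: leq_sum => y _; rewrite inE; case: ifP => // /andP[].
(* The bipartite graph between two classes has no induced 2K_2, so the
   neighbourhoods of the vertices of small degree form a chain. *)
have card_Lo a a' : a \in S -> a' \in S -> #|Lo a a'| <= tau.
  move=> aS aS'.
  have [->|[z zL]] := set_0Vmem (Lo a a'); first by rewrite cards0.
  have [y0 y0P] : exists y, (y \in M a) && (d a' y < tau).
    move: zL; rewrite inE => /andP[_ /exists_inP[y yM /andP[_ yt]]].
    by exists y; rewrite yM yt.
  pose y := [arg max_(y > y0 | (y \in M a) && (d a' y < tau)) d a' y].
  have [yM yt ymax] : [/\ y \in M a, d a' y < tau &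
     forall x, x \in M a -> d a' x < tau -> d a' x <= d a' y].
    rewrite /y; case: arg_maxnP => // x /andP[xM xt] xmax; split=> // x' xM' xt'.
    by apply: xmax; rewrite xM' xt'.
  apply: leq_trans (ltnW yt); apply: subset_leq_card.
  apply/subsetP => {z zL}z; rewrite [z \in Lo _ _]inE => /andP[zM].
  case/exists_inP => x xM /andP[xz xt]; rewrite inE zM /=.
  (* If y misses z, then x sees every neighbour z' of y in [M a']: otherwise a, x, z, a', z', y is a
     hexagon whose opposite vertices are nonadjacent. So x has larger degree than y. *)
  apply: contraTT (ymax x xM xt) => yz; rewrite -ltnNge.
  apply: proper_card; rewrite properEneq; apply/andP; split.
    by apply: contraNneq yz => /setP/(_ z); rewrite 2!in_set zM xz /= => ->.
  apply/subsetP => z'; rewrite 2!in_set => /andP[zM' yz'].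
  rewrite zM' /=; apply: contraT => xz'.
  have := hex a x z a' z' y; rewrite (negPf xz') [e z y]e_sym (negPf yz).
  rewrite (negPf (independentP _ iS _ _ aS aS')) /=; apply.
    move=> t; rewrite !in_cons in_nil !orbF.
    case/or4P => [/eqP->|/eqP->|/eqP->|/or3P[/eqP->|/eqP->|/eqP->]];
      by [exact: (subsetP SA)|apply: MA; eauto].
  rewrite (Mpar _ _ xM) xz (e_sym z) (Mpar _ _ zM) (Mpar _ _ zM') (e_sym z') yz'.
  by rewrite e_sym (Mpar _ _ yM).
(* The left side is the sum of the degrees inside W, each below n because neighbourhoods in a
   triangle-free graph are independent. *)
have sumE : \sum_(u in setX S S) E u.1 u.2 <= #|W| * n.
  rewrite (@card_fibers _ _ par W S) => [|y /parP[]//]; rewrite big_distrl /=.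
  rewrite (eq_bigl (fun u : T * T => (u.1 \in S) && (u.2 \in S))); last first.
    by move=> u; rewrite inE.
  rewrite -(pair_big (fun a => a \in S) (fun a => a \in S) E) /=; apply: leq_sum => a aS.
  rewrite /E exchange_big /= -sum_nat_const; apply: leq_sum => y yM.
  have yA := MA _ _ yM; apply: leq_trans (ltnW (nbr_lt y yA)).
  pose X := [set z in W | e y z].
  rewrite (_ : \sum_(a' in S) _ = #|X|); last first.
    rewrite (@card_fibers _ _ par X S) => [|z]; last first.
      by rewrite inE => /andP[/parP[]].
    by apply: eq_bigr => a' _; apply: eq_card => z; rewrite !inE andbAC.
  by apply/subset_leq_card/subsetP => z; rewrite 2!in_set => /andP[/WA-> ->].
have Sn := alpha S SA iS.
(* The weight of a pair bounds tau times the size of its cover: [E a a'] for [Hi] and tau^2 for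
   [Lo]. *)
have [f fP] := coloring_few_mono S (fun a a' => E a a' + tau ^ 2) q0.
move: fP; set mono := \sum_(u in _ | _) _ => fP.
pose P (u : T * T) := [&& u \in setX S S, u.1 != u.2 & f u.1 == f u.2].
pose Bad := \bigcup_(u | P u) (Hi u.1 u.2 :|: Lo u.1 u.2).
have badE : tau * #|Bad| <= mono.
  apply: leq_trans (leq_mul (leqnn _) (card_bigcup_leq _ _)) _.
  rewrite big_distrr /=; apply: leq_sum => u; rewrite /P inE.
  case/andP => /andP[u1 u2] _; apply: leq_trans (leq_mul (leqnn _) (leq_card_setU _ _)) _.
  by rewrite mulnDr leq_add // leq_mul2l card_Lo ?orbT.
(* Outside [Bad] each colour class is independent: the ends of an edge have distinct parents by
   triangle-freeness, and for parents of equal colour the cover was removed. *)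
have goodE : #|W :\: Bad| <= q * n.
  rewrite (@card_fibers _ _ (f \o par) _ setT) => [|//].
  rewrite -[q in q * _]card_ord -cardsT -sum_nat_const; apply: leq_sum => c _.
  apply/ltnW/alpha; first by apply/subsetP => y; rewrite !inE => /andP[/and3P[]].
  apply/independentP => y z; rewrite 2!in_set => /andP[/setDP[yW yB] /eqP yc] /andP[/setDP[zW zB] /eqP zc].
  apply/negP => yz.
  have [yS ey] := parP y yW; have [zS ez] := parP z zW.
  have yM : y \in M (par y) by rewrite inE yW eqxx.
  have zM : z \in M (par z) by rewrite inE zW eqxx.
  have pyz : par y != par z.
    apply/eqP => pe; have := tri y (par y) z.
    rewrite [e y _]e_sym ey pe ez yz => H.
    by have := H (WA _ yW) (subsetP SA _ zS) (WA _ zW) isT isT.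
  have Pu : P (par y, par z) by rewrite /P inE /= yS zS pyz; apply/eqP; exact: etrans yc (esym zc).
  have [yt|yt] := leqP tau (d (par z) y).
    case/bigcupP: yB; exists (par y, par z) => //=.
    by rewrite inE [y \in Hi _ _]inE yM yt.
  case/bigcupP: zB; exists (par y, par z) => //=.
  rewrite inE [z \in Lo _ _]inE zM; apply/orP; right; apply/exists_inP.
  by exists y => //; rewrite yz yt.
have sumw : \sum_(u in setX S S) (E u.1 u.2 + tau ^ 2) <= #|W| * n + tau ^ 2 * n ^ 2.
  rewrite big_split /= leq_add // sum_nat_const cardsX mulnC leq_mul2l.
  by rewrite expnS expn1 leq_mul ?orbT // ltnW.
have cW : #|W| <= #|W :\: Bad| + #|Bad|.
  by rewrite -(cardsID Bad W) addnC leq_add2l subset_leq_card ?subsetIr.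
have cA : #|A| <= #|W| + n.
  by rewrite -(cardsID S A) addnC leq_add2l (setIidPr SA) ltnW.
(* With n <= h^3 this becomes 7 |W| <= (8 + 64) h^2 n, and 72/7 + 1 < 12. *)
have key : q * tau * #|W| <= q * tau * (q * n) + (#|W| * n + tau ^ 2 * n ^ 2).
  apply: leq_trans (leq_mul (leqnn _) (leq_trans cW (leq_add goodE (leqnn _)))) _.
  rewrite mulnDr leq_add2l -mulnA; apply: leq_trans sumw; apply: leq_trans fP.
  by rewrite leq_mul2l badE orbT.
have k1 := leq_mul (leqnn #|W|) nh.
have k2 : tau ^ 2 * n ^ 2 <= 64 * h ^ 5 * n.
  rewrite (_ : _ * n = tau ^ 2 * (h ^ 3 * n)); last by rewrite /tau; lia.
  by rewrite leq_mul2l -mulnn leq_mul2r nh !orbT.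
have {}key : h ^ 3 * (7 * #|W|) <= h ^ 3 * (72 * h ^ 2 * n).
  by move: key k1 k2; rewrite /q /tau; lia.
move: key; rewrite leq_mul2l expn_eq0 eqn0Ngt h0 /= => key.
have k3 : n <= h ^ 2 * n by rewrite leq_pmull.
lia.
Qed.
End Graph.

Lemma independent_blue N (c : coloring N) (X : {set 'I_N}) :
  {in X &, forall x y, x != y -> red c x y} -> independent (blue c) X.
Proof.
move=> H; apply/independentP => x y xX yX.
have [->|xy] := eqVneq x y; first by rewrite blue_irr.
by have := H x y xX yX xy; rewrite redE => /andP[].
Qed.

(** * Red neighbourhoods in a coloring without irredundant 4-sets *)

Section RedNeighborhood.
Variables (N : nat) (c : coloring N).
Hypothesis no_irredundant :
  forall X : {set 'I_N}, #|X| = 4 -> ~~ irredundant (blue c) X.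
Local Notation e := (red c).

(** A red triangle together with v is a red K_4, that is, a blue-independent and hence irredundant
    4-set. *)
Lemma red_triangle_free (v : 'I_N) :
  {in [set y | e v y] & &, forall x y z, e x y -> e y z -> ~~ e x z}.
Proof.
move=> x y z; rewrite !inE => vx vy vz xy yz; apply/negP => xz.
have := no_irredundant (X := [set w in [:: v; x; y; z]]); rewrite cardsE.
have nE a b : e a b -> a == b = false by rewrite redE => /andP[/negPf].
have U : uniq [:: v; x; y; z] by rewrite /= !inE !(nE v, nE x, nE y).
rewrite (card_uniqP U) => /(_ erefl)/negP; apply.
apply/independent_irredundant/independent_blue => a b; rewrite !inE.
by do 2![case/or4P => /eqP->]; rewrite ?eqxx // red_sym.
Qed.

(** Otherwise v with the alternate vertices a1, b2, b3 is irredundant: v is red to the other three,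
    and each of these has its opposite vertex (a2, b4, b1 respectively) as private blue
    neighbour. *)
Lemma red_hexagon (v : 'I_N) (a1 b1 b2 a2 b3 b4 : 'I_N) :
  {subset [:: a1; b1; b2; a2; b3; b4] <= [set y | e v y]} ->
  path e a1 [:: b1; b2; a2; b3; b4; a1] ->
  [|| e a1 a2, e b1 b3 | e b2 b4].
Proof.
move=> sub /= /and5P[a1b1 b1b2 b2a2 a2b3 /and3P[b3b4 b4a1 _]].
have tri := red_triangle_free (v := v).
apply: contraT; rewrite !negb_or => /and3P[a1a2 b1b3 b2b4].
have Nv x : x \in [:: a1; b1; b2; a2; b3; b4] -> e v x.
  by move/sub; rewrite inE.
have [va1 vb1 vb2 va2] : [/\ e v a1, e v b1, e v b2 & e v a2].
  by split; apply: Nv; rewrite !inE eqxx ?orbT.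
have [vb3 vb4] : e v b3 /\ e v b4 by split; apply: Nv; rewrite !inE eqxx ?orbT.
have nE a b : e a b -> a == b = false by rewrite redE => /andP[/negPf].
have nE' a b : e a b -> b == a = false by rewrite eq_sym; apply: nE.
(* The hexagon is only a closed walk, so distinctness of its vertices is derived by exhibiting a red
   neighbour of one that is not a neighbour of the other. *)
have sep a b z : e a z -> ~~ e b z -> a == b = false.
  by move=> az; apply: contraNF => /eqP <-.
have [b1a1 b2b1 a2b2 b3a2] : [/\ e b1 a1, e b2 b1, e a2 b2 & e b3 a2].
  by split; rewrite red_sym.
have [b4b3 a1b4] : e b4 b3 /\ e a1 b4 by split; rewrite red_sym.
have nred a b : a == b = false -> ~~ e a b -> blue c a b.
  by move=> ab; rewrite redE ab negbK.
have blueF a b : e a b -> blue c a b = false by rewrite redE => /andP[_ /negPf].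
have a12 : a1 == a2 = false.
  apply: (sep _ _ b1) => //; rewrite red_sym.
  by have := tri b1 b2 a2; rewrite !inE => ->.
have b24 : b2 == b4 = false.
  apply: (sep _ _ b1) => //; rewrite red_sym.
  by have := tri b1 a1 b4; rewrite !inE => ->.
have b31 : b3 == b1 = false.
  rewrite eq_sym; apply: (sep _ _ a1) => //; rewrite red_sym.
  by have := tri a1 b4 b3; rewrite !inE => ->.
have U : uniq [:: v; a1; b2; b3].
  rewrite /= !inE !(nE v) //=.
  have -> : a1 == b2 = false by apply: (sep _ _ b4).
  have -> : a1 == b3 = false by apply: (sep _ _ b1) => //; rewrite red_sym.
  by have -> : b2 == b3 = false by rewrite eq_sym; apply: (sep _ _ b4).
have := no_irredundant (X := [set w in [:: v; a1; b2; b3]]); rewrite cardsE.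
rewrite (card_uniqP U) => /(_ erefl)/negP; case.
have priv x y : x \in [:: v; a1; b2; b3] -> ~~ e x y -> x == y = false ->
    y \notin [:: v; a1; b2; b3] ->
    {in [:: v; a1; b2; b3], forall z, z != x -> e z y} ->
  [exists y, private_neighbor (blue c) [set w in [:: v; a1; b2; b3]] x y].
  move=> xX xy xy' yX H; apply/existsP; exists y; rewrite /private_neighbor inE yX nred //=.
  apply/forall_inP => z; rewrite inE => zX; apply/implyP.
  by apply: contraTT => /(H _ zX)/blueF ->.
apply/forall_inP => x; rewrite !inE => /or4P[]/eqP->; apply/orP.
- left; apply/forall_inP => y; rewrite !inE => /or4P[]/eqP->;
    by rewrite ?blue_irr ?blueF.
- right; apply: (priv _ a2); rewrite ?inE ?eqxx ?orbT //.
    by rewrite !(eq_sym a2) a12 !nE.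
  by move=> z; rewrite !inE => /or4P[]/eqP->; rewrite ?eqxx // red_sym.
- right; apply: (priv _ b4); rewrite ?inE ?eqxx ?orbT //.
    by rewrite !(eq_sym b4) b24 !nE.
  by move=> z; rewrite !inE => /or4P[]/eqP->; rewrite ?eqxx // red_sym.
- right; apply: (priv _ b1); rewrite ?inE ?eqxx ?orbT //.
  + by rewrite red_sym.
  + by rewrite !(eq_sym b1) b31 !nE.
  by move=> z; rewrite !inE => /or4P[]/eqP->; rewrite ?eqxx // red_sym.
Qed.
End RedNeighborhood.

(** The closed red neighbourhoods of a maximal red-independent set, which has fewer than n elements,
    cover all vertices; each is bounded by [hexagon_card_bound]. *)
Lemma mixed_ramsey4_upper n h :
  n <= h ^ 3 -> mixed_ramsey 4 n <= n * (12 * n * h ^ 2 + 1).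
Proof.
move=> nh; rewrite /mixed_ramsey; case: ex_minnP => t _; apply.
set N := n * _.
apply/forallP => c; apply: contraT; rewrite negb_or.
case/andP => /existsPn no4 /existsPn non.
have no4' (X : {set 'I_N}) : #|X| = 4 -> ~~ irredundant (blue c) X.
  by move=> /eqP cX; have := no4 X; rewrite cX.
have alpha (X : {set 'I_N}) : independent (red c) X -> #|X| < n.
  move=> iX; rewrite ltnNge; apply/negP => /(independent_subset_card iX).
  by case=> Y [_ /eqP cY iY]; have := non Y; rewrite cY iY.
have [S [_ iS domS]] := maximal_independent (@red_sym _ c) (@red_irr _ c) setT.
have cover : setT \subset \bigcup_(a in S) (a |: [set y | red c a y]).
  apply/subsetP => y _; have [yS|yS] := boolP (y \in S).
    by apply/bigcupP; exists y => //; rewrite setU11.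
  have [a aS ay] := domS y (in_setT _) yS.
  by apply/bigcupP; exists a => //; rewrite !inE ay orbT.
have deg a : #|a |: [set y | red c a y]| <= 12 * n * h ^ 2 + 1.
  rewrite cardsU1 addnC leq_add ?leq_b1 //.
  apply: (hexagon_card_bound (@red_sym _ c) (@red_irr _ c) nh).
  - exact: red_triangle_free.
  - exact: red_hexagon.
  - by move=> X _; apply: alpha.
have := leq_trans (subset_leq_card cover) (card_bigcup_leq _ _).
rewrite cardsT card_ord leqNgt => /negP; case.
apply: leq_ltn_trans (leq_sum _ (fun a _ => deg a)) _.
by rewrite sum_nat_const ltn_mul2r addn1 alpha.
Qed.

Import Order.TTheory GRing.Theory Num.Theory.

(** * Counting independent sets *)

Lemma card_supersets (T : finType) (I : {set T}) N :
  #|[set W : {set T} | I \subset W & #|W| == N]| <= 'C(#|T| - #|I|, N - #|I|).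
Proof.
have -> : #|T| - #|I| = #|~: I| by rewrite -(cardsC I) addKn.
rewrite -cards_draws -(@card_in_imset _ _ (fun W : {set T} => W :\: I)).
  apply/subset_leq_card/subsetP => _ /imsetP[W + ->].
  rewrite !inE => /andP[IW /eqP <-].
  by rewrite cardsD (setIidPr IW) eqxx setDE subsetIr.
move=> W W'; rewrite !inE => /andP[IW _] /andP[IW' _] eqWI.
by rewrite -(setID W I) -(setID W' I) eqWI (setIidPr IW) (setIidPr IW').
Qed.

(** The quotient of the binomials is the product of (N - i)/(M - i) over i < t, and each factor is
    at most N/M <= 1/K. *)
Lemma bin_sub_ratio K M N t :
  0 < K -> t <= N -> K * N <= M -> K ^ t * 'C(M - t, N - t) <= 'C(M, N).
Proof.
move=> K0; elim: t N M => [|t IH] N M; first by rewrite !subn0 mul1n.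
case: N => // N; case: M => [|M] tN KM; first by nia.
rewrite !subSS -(leq_pmul2l (ltn0Sn N)) -mul_bin_diag /= expnS.
have := IH N M tN ltac:(nia); nia.
Qed.

(** Union bound: a random N-subset contains a given t-set with probability at most K^(-t). *)
Lemma exists_subset_no_independent (T : finType) (e : rel T) K N t :
  0 < t -> 0 < K -> K * N <= #|T| ->
  #|[set I : {set T} | independent e I & #|I| == t]| < K ^ t ->
  exists2 W : {set T}, #|W| = N &
    forall I : {set T}, I \subset W -> independent e I -> #|I| != t.
Proof.
move=> t0 K0 KN; set D := [set I | _ & _] => D_lt.
have NT : N <= #|T| by apply: leq_trans KN; rewrite leq_pmull.
have [Nt|tN] := ltnP N t.
  have : 0 < 'C(#|[set: T]|, N) by rewrite bin_gt0 cardsT.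
  rewrite -cards_draws => /card_gt0P[W]; rewrite inE => /andP[_ /eqP cW].
  exists W => // I /subset_leq_card; rewrite cW => IN _.
  by rewrite neq_ltn (leq_ltn_trans IN Nt).
pose P (W : {set T}) := [exists I in D, I \subset W].
have [/existsP[W /andP[/eqP cW]]|] := boolP [exists W : {set T}, (#|W| == N) && ~~ P W].
  rewrite negb_exists_in => /forall_inP H; exists W => // I IW iI.
  by apply: contraTneq IW => cI; apply: H; rewrite inE iI cI eqxx.
rewrite negb_exists => /forallP H.
have : 'C(#|T|, N) <= \sum_(I in D) #|[set W : {set T} | I \subset W & #|W| == N]|.
  rewrite -cardsT -cards_draws.
  apply: leq_trans (card_bigcup_leq (mem D) _).
  apply/subset_leq_card/subsetP => W; rewrite !inE => /andP[_ cW].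
  have := H W; rewrite cW negbK => /exists_inP[I ID IW].
  by apply/bigcupP; exists I => //; rewrite inE IW.
have le I : I \in D ->
    #|[set W : {set T} | I \subset W & #|W| == N]| <= 'C(#|T| - t, N - t).
  by rewrite inE => /andP[_ /eqP <-]; apply: card_supersets.
move=> /leq_trans-/(_ _ (leq_sum _ le)); rewrite sum_nat_const leqNgt => /negP[].
apply: leq_trans (bin_sub_ratio K0 tN KN).
rewrite ltn_pmul2r // bin_gt0; lia.
Qed.

Local Open Scope ring_scope.

Section IndependencePolynomial.
Variables (R : realFieldType) (T : finType) (e : rel T).
Variable x : R.
Hypothesis x_ge0 : 0 <= x.

Definition indpoly (U : {set T}) : R :=
  \sum_(I : {set T} | (I \subset U) && independent e I) x ^+ #|I|.

Lemma indpoly_set0 : indpoly set0 = 1.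
Proof.
rewrite /indpoly (big_pred1 set0) ?cards0 // => I.
rewrite subset0 /=; have [->|//] := eqVneq I set0.
by apply/independentP => y; rewrite inE.
Qed.

Lemma indpoly_le (U V : {set T}) : U \subset V -> indpoly U <= indpoly V.
Proof.
move=> UV; rewrite /indpoly big_mkcond [leRHS]big_mkcond; apply: ler_sum => I _.
case: ifP => [/andP[IU ->]|_]; first by rewrite (subset_trans IU UV).
by case: ifP => //; rewrite exprn_ge0.
Qed.

(** An independent set either avoids u or is u together with an independent set of
    non-neighbours. *)
Lemma indpoly_rec (U : {set T}) u : u \in U ->
  indpoly U <= indpoly (U :\ u) + x * indpoly [set z in U :\ u | ~~ e u z].
Proof.
move=> uU; rewrite {1}/indpoly (bigID (fun I : {set T} => u \in I)) /= addrC.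
apply: lerD.
  rewrite /indpoly big_mkcond [leRHS]big_mkcond; apply: ler_sum => I _.
  case: ifP => [/andP[/andP[IU ->] uI]|_].
    by rewrite subsetD1 IU uI.
  by case: ifP => //; rewrite exprn_ge0.
rewrite (reindex_onto (fun J => u |: J) (fun I => I :\ u)) /=; last first.
  by move=> I /andP[_ uI]; rewrite setD1K.
rewrite /indpoly mulr_sumr big_mkcond [leRHS]big_mkcond /=; apply: ler_sum => J _.
case: ifP => [|_]; last by case: ifP => // _; rewrite mulr_ge0 ?exprn_ge0.
case/andP => /andP[/andP[JU iJ] _] /eqP JE.
have uJ : u \notin J by rewrite -JE !inE eqxx.
rewrite cardsU1 uJ exprS ifT //.
have /(independent_sub (subsetUr _ _)) -> := iJ; rewrite andbT.
apply/subsetP => z zJ; rewrite !inE.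
have -> /= : z != u by apply: contraNneq uJ => <-.
rewrite (subsetP JU) ?inE ?zJ ?orbT //=.
by apply: (independentP _ _ iJ); rewrite !inE ?eqxx ?zJ ?orbT.
Qed.

Lemma indpoly_le_expr (U : {set T}) : indpoly U <= (1 + x) ^+ #|U|.
Proof.
have [n] := ubnP #|U|; elim: n U => // n IH U.
have [->|[u uU]] := set_0Vmem U; first by rewrite indpoly_set0 cards0.
rewrite (cardsD1 u) uU /= !add1n !ltnS => Un.
apply: le_trans (indpoly_rec uU) _; rewrite exprS mulrDl mul1r.
have le1 := IH _ Un; apply: lerD => //; apply: ler_wpM2l => //.
apply: le_trans le1; apply: indpoly_le.
by apply/subsetP => z; rewrite inE => /andP[].
Qed.

Lemma card_independent_le_indpoly t :
  #|[set I : {set T} | independent e I & #|I| == t]|%:R * x ^+ t <= indpoly setT.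
Proof.
rewrite /indpoly (bigID (fun I : {set T} => #|I| == t)) /=.
rewrite -[leLHS]addr0; apply: lerD; last by apply: sumr_ge0 => I _; rewrite exprn_ge0.
rewrite mulr_natl -sumr_const big_mkcond [leRHS]big_mkcond /=; apply: ler_sum => I _.
rewrite inE subsetT /=.
by case: ifP => // /andP[_ /eqP ->].
Qed.

(* Kleitman-Winston: branching on a vertex of relative degree at least beta
   either deletes it or shrinks the available set by the factor 1 - beta. *)
Lemma indpoly_bound (beta : R) (r j : nat) (U : {set T}) :
  0 <= beta <= 1 ->
  (forall U : {set T}, (r < #|U|)%N ->
     exists2 u, u \in U & beta * #|U|%:R <= #|[set z in U | e u z]|%:R) ->
  #|U|%:R * (1 - beta) ^+ j <= r%:R ->
  indpoly U <= (1 + x) ^+ r * (1 + x * #|T|%:R) ^+ j.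
Proof.
move=> /andP[b0 b1] dens; have x0 := x_ge0; elim: j U => [|j IHj] U.
  rewrite !expr0 !mulr1 ler_nat => Ur; apply: le_trans (indpoly_le_expr U) _.
  by apply: ler_weXn2l => //; lra.
set C := (1 + x) ^+ r * (1 + x * #|T|%:R) ^+ j in IHj *.
have xT : 0 <= x * #|T|%:R by rewrite mulr_ge0.
have C_ge : (1 + x) ^+ r <= C.
  by rewrite /C ler_peMr ?exprn_ge0 ?exprn_ege1 //; lra.
have C0 : 0 <= C by apply: le_trans C_ge; rewrite exprn_ge0; lra.
(* Inner induction over deletions with j fixed: each deleted vertex costs one extra x C, from the
   branch that keeps it and shrinks the set. This accumulates to x |V| C. *)
have main : forall n (V : {set T}), (#|V| < n)%N ->
    #|V|%:R * (1 - beta) ^+ j.+1 <= r%:R -> indpoly V <= C * (1 + x * #|V|%:R).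
  elim=> // n IHn V; rewrite ltnS => Vn Vr.
  have xV : 0 <= x * #|V|%:R by rewrite mulr_ge0.
  have [Vr'|rV] := leqP #|V| r.
    apply: le_trans (indpoly_le_expr V) _; apply: (@le_trans _ _ C); last by nra.
    by apply: le_trans C_ge; apply: ler_weXn2l => //; lra.
  have [u uV deg] := dens V rV.
  apply: le_trans (indpoly_rec uV) _.
  have cV : #|V| = #|V :\ u|.+1 by rewrite (cardsD1 u) uV.
  have h1 : indpoly (V :\ u) <= C * (1 + x * #|V :\ u|%:R).
    apply: IHn; first by rewrite -cV.
    apply: le_trans Vr; apply: ler_wpM2r; first by rewrite exprn_ge0 //; lra.
    by rewrite ler_nat cV.
  set V' := [set z in V :\ u | _].
  have cV' : #|V'|%:R <= #|V|%:R * (1 - beta).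
    have : (#|V'| + #|[set z in V | e u z]| <= #|V|)%N.
      rewrite -cardsUI (_ : V' :&: _ = set0) ?cards0 ?addn0.
        by apply/subset_leq_card/subsetP => z; rewrite !inE; case/orP => /andP[]; [case/andP|].
      by apply/setP => z; rewrite !inE; case: (e u z); rewrite ?andbF.
    rewrite -(ler_nat R) natrD; lra.
  have h2 : indpoly V' <= C.
    apply: IHj; apply: le_trans Vr; rewrite exprS mulrA.
    by apply: ler_wpM2r; rewrite ?exprn_ge0 //; lra.
  have h3 := ler_wpM2l x_ge0 h2.
  apply: le_trans (lerD h1 h3) _; rewrite cV -natr1; lra.
move=> Ur; apply: le_trans (main _ _ (ltnSn _) Ur) _.
rewrite exprSr mulrA; apply: ler_wpM2l => //.
by rewrite lerD2l ler_wpM2l // ler_nat max_card.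
Qed.
End IndependencePolynomial.

(** * Random bipartition of a partial linear space *)

Lemma expr1D_le (R : realFieldType) (x : R) n :
  0 <= x -> 2 * n%:R * x <= 1 -> (1 + x) ^+ n <= 1 + 2 * n%:R * x.
Proof.
move=> x0; elim: n => [|n IH]; first by rewrite expr0; lra.
rewrite exprSr -natr1 => nx.
have xn : 0 <= x * n%:R by rewrite mulr_ge0.
have {}IH := IH ltac:(lra).
have : (1 + x) ^+ n * (1 + x) <= (1 + 2 * n%:R * x) * (1 + x).
  by apply: ler_wpM2r => //; lra.
move=> /le_trans; apply; nra.
Qed.

Lemma sum_subsets_expr (R : realFieldType) (T : finType) (x : R) :
  \sum_(U : {set T}) x ^+ #|U| = (1 + x) ^+ #|T|.
Proof.
have -> : (1 + x) ^+ #|T| = \prod_(i : T) (x + 1).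
  by rewrite prodr_const addrC.
rewrite bigA_distr /=; apply: eq_bigr => U _.
by rewrite -big_mkcond /= prodr_const.
Qed.

Section RandomBipartition.
Variables (Pt Ln : finType) (inc : Ln -> Pt -> bool).

(** [f p l] is the side of l at the point p; the clique of lines through p becomes complete
    bipartite. *)
Definition bicolored (f : {ffun Pt -> {ffun Ln -> bool}}) : rel Ln :=
  fun l m => [exists p, [&& inc l p, inc m p & f p l != f p m]].

Lemma bicolored_sym f : symmetric (bicolored f).
Proof.
move=> l m; apply: eq_existsb => p.
by rewrite andbCA eq_sym.
Qed.

Lemma bicolored_irr f : irreflexive (bicolored f).
Proof.
move=> l; apply/negbTE; rewrite negb_exists.
by apply/forallP => p; rewrite eqxx !andbF.
Qed.

Let cls (f : {ffun Pt -> {ffun Ln -> bool}}) (b : bool) (U : {set Ln}) p :=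
  #|[set l in U | inc l p & f p l == b]|.
Let minority f U p := minn (cls f true U p) (cls f false U p).

(** Bound y^(min a b) by y^a + y^b; the sum over f of the resulting product then factors over points
    and lines. *)
Lemma sum_minority (R : realFieldType) (U : {set Ln}) (y : R) : 0 <= y ->
  \sum_f \prod_p y ^+ minority f U p <=
  \prod_p (2 * ((1 + y) ^+ #|[set l in U | inc l p]| *
                2 ^+ #|~: [set l in U | inc l p]|)).
Proof.
move=> y0.
pose w p b (g : {ffun Ln -> bool}) :=
  \prod_l (if (l \in [set l in U | inc l p]) && (g l == b) then y else 1).
have wE f b p : y ^+ cls f b U p = w p b (f p).
  rewrite /w -big_mkcond prodr_const; congr (_ ^+ _); apply: eq_card => l.
  by rewrite inE [RHS]unfold_in inE andbA.
have sumw p b : \sum_g w p b g =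
    (1 + y) ^+ #|[set l in U | inc l p]| * 2 ^+ #|~: [set l in U | inc l p]|.
  rewrite /w -(bigA_distr_bigA (fun l (c : bool) =>
    if (l \in [set l in U | inc l p]) && (c == b) then y else 1)) /=.
  rewrite (bigID (mem [set l in U | inc l p])) /=; congr (_ * _).
    rewrite -prodr_const; apply: eq_bigr => l ->.
    by rewrite big_bool; case: b => /=; rewrite // addrC.
  rewrite -prodr_const; apply: eq_big => [l|l /negPf ->]; first by rewrite in_setC.
  by rewrite big_bool.
apply: (@le_trans _ _ (\sum_(f : {ffun Pt -> {ffun Ln -> bool}}) \prod_p (w p true (f p) + w p false (f p)))).
  apply: ler_sum => f _; apply: ler_prod => p _; rewrite exprn_ge0 //= -!wE.
  by rewrite /minority /minn; case: ifP => _; rewrite ?lerDl ?lerDr exprn_ge0.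
rewrite -(bigA_distr_bigA (fun p g => w p true g + w p false g)) /=.
apply: ler_prod => p _; rewrite big_split /= !sumw -mulr2n mulr_natl lexx andbT.
by rewrite mulrn_wge0 // mulr_ge0 // exprn_ge0 //; lra.
Qed.

Variable q' : nat.
Let q := (8 * q')%N.
Hypothesis q'_gt0 : (0 < q')%N.
Hypothesis card_line : forall l, (q <= #|[set p | inc l p]|)%N.
Hypothesis card_Pt : (#|Pt| <= q ^ 3)%N.
Hypothesis card_Ln : (4 * #|Ln| <= 4 ^ q')%N.
Hypothesis line_inj : forall l m p p',
  l != m -> inc l p -> inc m p -> inc l p' -> inc m p' -> p = p'.

(** Exponential Markov inequality with y = 1/3. For n = |U| q' there are at least 8n incidences with
    U and at most n points, so the proportion of bad f is at most (3 * 2 * (2/3)^8)^n, and 1536/6561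
    < 1/4. *)
Lemma card_few_bicolored (R : realFieldType) (U : {set Ln}) :
  (8 * q ^ 2 <= #|U|)%N ->
  #|[set f | (\sum_p minority f U p <= #|U| * q')%N]|%:R <=
  #|{ffun Pt -> {ffun Ln -> bool}}|%:R * (4^-1 ^+ q') ^+ #|U| :> R.
Proof.
move=> cU; set B := [set f | _]; set n := (#|U| * q')%N.
pose y : R := 3^-1.
have y0 : 0 <= y by rewrite /y; lra.
have y1 : y <= 1 by rewrite /y; lra.
have lower : #|B|%:R * y ^+ n <= \sum_f \prod_p y ^+ minority f U p.
  rewrite mulr_natl -sumr_const big_mkcond; apply: ler_sum => f _.
  rewrite prodrXr inE; case: ifP => [fn|_]; last by rewrite exprn_ge0.
  by apply: ler_wiXn2l.
have := le_trans lower (sum_minority U y0).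
rewrite big_split /= prodr_const.
have -> : \prod_p ((1 + y) ^+ #|[set l in U | inc l p]| * 2 ^+ #|~: [set l in U | inc l p]|)
  = (2 ^+ #|Ln|) ^+ #|Pt| * (\prod_p (2 / 3) ^+ #|[set l in U | inc l p]|) :> R.
  rewrite -[(2 ^+ _) ^+ _]prodr_const -big_split /=; apply: eq_bigr => p _.
  rewrite -(cardsC [set l in U | inc l p]) exprD mulrAC -exprMn.
  by congr (_ ^+ _ * _); rewrite /y; lra.
rewrite prodrXr.
have cD : (8 * n <= \sum_p #|[set l in U | inc l p]|)%N.
  rewrite /n (_ : (8 * _ = #|U| * q)%N); last by rewrite /q; lia.
  rewrite -sum_nat_const.
  have -> : (\sum_p #|[set l in U | inc l p]| = \sum_(l in U) #|[set p | inc l p]|)%N.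
    rewrite (eq_bigr (fun p => \sum_(l in U) (inc l p : nat))) /=; last first.
      move=> p _; rewrite -sum1_card [RHS]big_mkcond [LHS]big_mkcond /=.
      by apply: eq_bigr => l _; rewrite inE; case: (l \in U); case: (inc l p).
    rewrite exchange_big /=; apply: eq_bigr => l _.
    by rewrite -sum1_card [RHS]big_mkcond /=; apply: eq_bigr => p _; rewrite inE; case: (inc l p).
  by apply: leq_sum => l _; apply: card_line.
have cP : (#|Pt| <= n)%N.
  by apply: leq_trans card_Pt _; rewrite /n /q in cU *; nia.
move=> H.
have {}H : #|B|%:R * y ^+ n <= 2 ^+ n * ((2 ^+ #|Ln|) ^+ #|Pt| * (2 / 3) ^+ (8 * n)) :> R.
  apply: le_trans H _; apply: ler_pM.
  - by rewrite exprn_ge0.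
  - by rewrite mulr_ge0 ?exprn_ge0 //; lra.
  - by apply: ler_weXn2l => //; lra.
  - apply: ler_wpM2l; first by rewrite !exprn_ge0.
    by apply: ler_wiXn2l => //; lra.
rewrite card_ffun [#|{ffun Ln -> bool}|]card_ffun card_bool !natrX.
have -> : #|B|%:R = #|B|%:R * y ^+ n * 3 ^+ n :> R.
  by rewrite -mulrA -exprMn (_ : y * 3 = 1) ?expr1n ?mulr1 // /y; lra.
apply: le_trans (ler_wpM2r _ H) _; first by rewrite exprn_ge0.
rewrite mulrCA -mulrA; apply: ler_wpM2l; first by rewrite !exprn_ge0.
rewrite exprM -!exprMn -exprM [(q' * _)%N]mulnC.
by apply: lerXn2r; rewrite ?nnegrE ?exprS ?expr0; lra.
Qed.

(** Union bound over all nonempty U: the failure probabilities sum to at most (1 + 4^(-q'))^|Ln| - 1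
    <= 1/2 by [card_Ln]. *)
Lemma exists_bipartition : exists f : {ffun Pt -> {ffun Ln -> bool}},
  forall U : {set Ln}, (8 * q ^ 2 <= #|U|)%N ->
  (#|U| * q' < \sum_p minority f U p)%N.
Proof.
pose B (U : {set Ln}) := [set f | (\sum_p minority f U p <= #|U| * q')%N].
pose big (U : {set Ln}) := (8 * q ^ 2 <= #|U|)%N.
have [/existsP[f fB]|] := boolP [exists f, f \notin \bigcup_(U | big U) B U].
  exists f => U bU; rewrite ltnNge; apply: contra fB => fU.
  by apply/bigcupP; exists U => //; rewrite inE.
rewrite negb_exists => /forallP H.
set Tot := #|{ffun Pt -> {ffun Ln -> bool}}|.
have Tot0 : (0 < Tot)%N by apply/card_gt0P; exists [ffun=> [ffun=> true]].
have : (Tot <= \sum_(U | big U) #|B U|)%N.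
  apply: leq_trans (card_bigcup_leq _ _); rewrite /Tot -cardsT.
  by apply/subset_leq_card/subsetP => f _; have := H f; rewrite negbK.
rewrite -(ler_nat rat) natr_sum => H1.
have {}H1 : Tot%:R <= \sum_(U | big U) Tot%:R * (4^-1 ^+ q') ^+ #|U| :> rat.
  by apply: le_trans H1 _; apply: ler_sum => U bU; apply: card_few_bicolored.
set x : rat := 4^-1 ^+ q' in H1.
have x0 : 0 <= x by rewrite /x exprn_ge0.
have {}H1 : Tot%:R <= Tot%:R * ((1 + x) ^+ #|Ln| - 1).
  apply: le_trans H1 _; rewrite -mulr_sumr; apply: ler_wpM2l => //.
  have -> : (1 + x) ^+ #|Ln| - 1 = \sum_(U : {set Ln} | U != set0) x ^+ #|U|.
    by rewrite -sum_subsets_expr (bigD1 set0) //= cards0 expr0 addrC addrK.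
  rewrite big_mkcond [leRHS]big_mkcond; apply: ler_sum => U _ /=.
  case: ifP => [bU|_]; last by case: ifP => //; rewrite exprn_ge0.
  rewrite ifT //; apply: contraTneq bU => ->; rewrite /big cards0 /q -ltnNge; nia.
have xL : 4 * #|Ln|%:R * x <= 1.
  rewrite /x exprVn -natrM -natrX ler_pdivrMr ?mul1r ?ler_nat //.
  by rewrite ltr0n expn_gt0.
have Lx : 0 <= #|Ln|%:R * x by rewrite mulr_ge0.
have nx : 2 * #|Ln|%:R * x <= 1 by move: xL Lx; rewrite -!mulrA; lra.
have Tot0' : (0 : rat) < Tot%:R by rewrite ltr0n.
move: H1 (expr1D_le x0 nx) xL; rewrite -{1}[Tot%:R]mulr1 ler_pM2l // -!mulrA.
lra.
Qed.

(** Each point contributes at least the square of its minority to the degree sum in U, and no pair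
    is counted twice since two lines share at most one point. Convexity then bounds the average
    degree from below. *)
Lemma bicolored_dense (R : realFieldType) : exists f : {ffun Pt -> {ffun Ln -> bool}},
  forall U : {set Ln}, (8 * q ^ 2 < #|U|)%N ->
  exists2 u, u \in U &
    (64 * q)%:R^-1 * #|U|%:R <= #|[set z in U | bicolored f u z]|%:R :> R.
Proof.
have [f fP] := exists_bipartition; exists f => U cU.
have U0 : (0 < #|U|)%N by apply: leq_ltn_trans cU.
have q0 : (0 < q)%N by rewrite /q; lia.
have mU := fP U (ltnW cU).
have degs : (\sum_p minority f U p ^ 2 <=
             \sum_(u in U) #|[set z in U | bicolored f u z]|)%N.
  apply: (@leq_trans (\sum_p cls f true U p * cls f false U p)).
    by apply: leq_sum => p _; rewrite -mulnn leq_mul ?geq_minl ?geq_minr.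
  pose X p u z := [&& u \in U, inc u p, f p u == true, z \in U, inc z p & f p z == false].
  have -> : (\sum_p cls f true U p * cls f false U p = \sum_u \sum_z \sum_p X p u z)%N.
    under [RHS]eq_bigr do rewrite exchange_big /=.
    rewrite [RHS]exchange_big /=; apply: eq_bigr => p _.
    rewrite /cls -2!sum1_card big_distrl /= big_mkcond /=; apply: eq_bigr => u _.
    rewrite !inE /X; case: ifP => [/and3P[-> -> ->]|nu]; last first.
      rewrite big1 // => z _; apply/eqP; rewrite eqb0.
      by apply: contraFN nu => /and4P[-> -> -> _].
    by rewrite mul1n big_mkcond /=; apply: eq_bigr => z _; rewrite !inE; case: ifP.
  rewrite [leqRHS]big_mkcond /=; apply: leq_sum => u _.
  case: ifPn => [uU|uU]; last first.
    by rewrite big1 // => z _; rewrite big1 // => p _; rewrite /X (negPf uU).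
  rewrite -sum1_card [leqRHS]big_mkcond /=; apply: leq_sum => z _; rewrite inE.
  have [p Xp|X0] := pickP (fun p => X p u z); last by rewrite big1 // => p _; rewrite X0.
  have /and5P[_ iu /eqP fu zU /andP[iz /eqP fz]] := Xp.
  rewrite zU (_ : bicolored f u z); last first.
    by apply/existsP; exists p; rewrite iu iz fu fz.
  have uz : u != z by apply/eqP => E; rewrite E fz in fu.
  rewrite (bigD1 p) //= big1 ?addn0 ?leq_b1 // => p' p'p; apply/eqP; rewrite eqb0.
  apply: contra p'p => /and5P[_ iu' _ _ /andP[iz' _]].
  by apply/eqP; apply: line_inj iu' iz' iu iz.
have [/exists_inP[u uU]|] := boolP [exists u in U,
   (64 * q)%:R^-1 * #|U|%:R <= #|[set z in U | bicolored f u z]|%:R :> R].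
  by exists u.
rewrite negb_exists_in => /forall_inP small.
(* Lower bound for the mean minority, (|U| q / 8) / q^3. The tangent inequality a^2 >= 2 tau a -
   tau^2 replaces Cauchy-Schwarz. *)
pose tau : R := #|U|%:R / (8 * q ^ 2)%:R.
have sq : \sum_p (2 * tau * (minority f U p)%:R - tau ^+ 2) <=
    \sum_(u in U) #|[set z in U | bicolored f u z]|%:R :> R.
  apply: (@le_trans _ _ (\sum_p (minority f U p ^ 2)%:R)).
    apply: ler_sum => p _; rewrite natrX; set a := (minority _ _ _)%:R.
    have := sqr_ge0 (a - tau); nra.
  by rewrite -!natr_sum ler_nat.
have up : \sum_(u in U) #|[set z in U | bicolored f u z]|%:R <
    \sum_(u in U) (64 * q)%:R^-1 * #|U|%:R :> R.
  apply: ltr_sum => [|u uU]; last by have := small u uU; rewrite -ltNge.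
  have [u uU] := card_gt0P U0; apply/hasP; exists u => //=.
  by rewrite ?mem_index_enum ?uU.
have := le_lt_trans sq up; rewrite sumr_const -mulr_natl.
rewrite big_split /= sumrN sumr_const -mulr_sumr -natr_sum -[_ *+ #|Pt|]mulr_natl.
have h1 : (#|U| * q')%:R <= (\sum_p minority f U p)%:R :> R by rewrite ler_nat ltnW.
have h2 : #|Pt|%:R <= (q%:R) ^+ 3 :> R by rewrite -natrX ler_nat.
have q'R : 0 < q'%:R :> R by rewrite ltr0n.
have qE : q%:R = 8 * q'%:R :> R by rewrite /q natrM.
have tau0 : 0 <= tau by rewrite /tau divr_ge0.
have qR : 0 < q%:R :> R by rewrite ltr0n.
have UE : #|U|%:R = tau * (8 * q%:R ^+ 2).
  by rewrite /tau natrM natrX; field; lra.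
have q'E : q'%:R = q%:R / 8 :> R by rewrite qE; field.
have {}h1 : tau * q%:R ^+ 3 <= (\sum_p minority f U p)%:R :> R.
  apply: le_trans h1; rewrite natrM UE q'E le_eqVlt; apply/orP; left.
  by apply/eqP; field.
have {}h1 := ler_wpM2l (mulr_ge0 (ler0n R 2) tau0) h1.
have {}h2 := ler_wpM2r (sqr_ge0 tau) h2.
rewrite mulr1 -[ltRHS]mulr_natr UE.
have -> : (64 * q)%:R^-1 * (tau * (8 * q%:R ^+ 2)) * (tau * (8 * q%:R ^+ 2))
  = tau ^+ 2 * q%:R ^+ 3 by rewrite natrM; field; lra.
have : 2 * tau * (tau * q%:R ^+ 3) = 2 * (tau ^+ 2 * q%:R ^+ 3) by ring.
move: h1 h2; lra.
Qed.
End RandomBipartition.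

(** * The Hermitian curve *)

Section HermitianCurve.
Variables (F : fieldType) (s : F -> F).
Hypotheses (sD : {morph s : x y / x + y}) (sM : {morph s : x y / x * y}).
Hypothesis sK : involutive s.

Definition on_curve (P : F * F) := P.1 * s P.1 == P.2 + s P.2.
Definition on_line (l P : F * F) := P.2 == l.1 * P.1 + l.2.
(** For y = a x + b the curve equation reads (x - s a) s(x - s a) = a s(a) + b + s(b); the line is
    tangent when the right side vanishes. *)
Definition secant (l : F * F) := l.1 * s l.1 + l.2 + s l.2 != 0.
(** The Hermitian form on the vectors (x, y, 1), for which the points of the curve are isotropic. *)
Let h (P Q : F * F) := P.1 * s Q.1 - P.2 - s Q.2.

Let s0 : s 0 = 0.
Proof. by apply: (addrI (s 0)); rewrite -sD !addr0. Qed.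

Let sN : {morph s : x / - x}.
Proof. by move=> x; apply: (addrI (s x)); rewrite -sD !subrr s0. Qed.

Let s_eq0 x : (s x == 0) = (x == 0).
Proof. by apply/eqP/eqP => [|->]; rewrite ?s0 // => /(congr1 s); rewrite sK s0. Qed.

Let h_diag P : on_curve P -> h P P = 0.
Proof. by move=> /eqP E; rewrite /h E; ring. Qed.

Let L (l P : F * F) := P.2 - l.1 * P.1 - l.2.

Let L_eq0 l P : (L l P == 0) = on_line l P.
Proof. by rewrite /on_line -[RHS]subr_eq0 /L opprD addrA. Qed.

(* The vector L(B) A - L(A) B is proportional to D, hence isotropic. *)
Let transversal l m A B D : on_curve A -> on_curve B -> on_curve D ->
  on_line l A -> on_line l B -> on_line l D -> on_line m D ->
  L m B * s (L m A) * h A B + s (L m B) * L m A * h B A = 0.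
Proof.
move=> /h_diag hA /h_diag hB /h_diag hD /eqP lA /eqP lB /eqP lD /eqP mD.
set a := L m A; set b := L m B.
have slD : l.1 * D.1 + l.2 = m.1 * D.1 + m.2 by rewrite -lD -mD.
have e1 : b * A.1 - a * B.1 = (b - a) * D.1.
  rewrite /a /b /L lA lB.
  have -> : m.2 = l.1 * D.1 + l.2 - m.1 * D.1 by rewrite slD; ring.
  by ring.
have e2 : b * A.2 - a * B.2 = (b - a) * D.2.
  rewrite lA lB lD.
  have -> : b * (l.1 * A.1 + l.2) - a * (l.1 * B.1 + l.2) =
            l.1 * (b * A.1 - a * B.1) + (b - a) * l.2 by ring.
  by rewrite e1; ring.
clearbody a b; have e1s := congr1 s e1; have e2s := congr1 s e2.
rewrite !(sD, sN, sM) in e1s e2s.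
have : (b - a) * (s b - s a) * h D D = 0 by rewrite hD mulr0.
have -> : (b - a) * (s b - s a) * h D D =
  ((b - a) * D.1) * ((s b - s a) * s D.1) - (b - a) * D.2 * (s b - s a)
  - (b - a) * ((s b - s a) * s D.2) by rewrite /h; ring.
rewrite -e1 -e2 -e1s -e2s => E.
have : (b * A.1 - a * B.1) * (s b * s A.1 - s a * s B.1) -
  (b * A.2 - a * B.2) * (s b - s a) - (b - a) * (s b * s A.2 - s a * s B.2)
  = b * s b * h A A + a * s a * h B B - (b * s a * h A B + s b * a * h B A).
  by rewrite /h; ring.
by rewrite E hA hB !mulr0 !add0r => /esym/eqP; rewrite oppr_eq0 => /eqP.
Qed.

Let line_inj l P Q : on_line l P -> on_line l Q -> P.1 = Q.1 -> P = Q.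
Proof.
by case: P Q => [x y] [x' y'] /eqP /= -> /eqP /= -> ->.
Qed.

Let line_sub l P Q : on_line l P -> on_line l Q -> P.2 - Q.2 = l.1 * (P.1 - Q.1).
Proof. by move=> /eqP-> /eqP->; ring. Qed.

Let same_slope l m P Q : on_line l P -> on_line m P -> l.1 = m.1 ->
  on_line l Q -> on_line m Q.
Proof.
rewrite /on_line => /eqP -> /eqP E lm /eqP ->; rewrite lm in E *.
by rewrite (@addrI _ _ _ _ E).
Qed.

(** Subtracting h A A = 0 factors h A B; its first factor vanishes only if the line is tangent, its
    second only if A = B. *)
Let h_neq0 l A B : secant l -> on_curve A -> on_line l A -> on_line l B ->
  A <> B -> h A B != 0.
Proof.
move=> sec hA lA lB AB.
have -> : h A B = (A.1 - s l.1) * s (B.1 - A.1).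
  have := line_sub lB lA => /(congr1 s); rewrite sM => E.
  rewrite -[LHS]subr0 -(h_diag hA) mulrBl -E /h !sD !sN; ring.
rewrite mulf_neq0 ?s_eq0 ?subr_eq0 //; last first.
  by apply/eqP => /esym /(line_inj lA lB).
apply: contraNneq sec => A1; move: hA; rewrite /on_curve (eqP lA) A1 !(sD, sM) !sK.
move/eqP => E; apply/eqP.
have -> : l.1 * s l.1 + l.2 + s l.2 =
  (l.1 * s l.1 + l.2 + (s l.1 * l.1 + s l.2)) - s l.1 * l.1 by ring.
by rewrite -E subrr.
Qed.

(* If the four lines were in general position, the scaled intersection points
   A, B, C of the first three would span the whole space, but the relations given by the
   fourth line make their Gram matrix singular. *)
Lemma onan_free (l1 l2 l3 l4 A B C D E G : F * F) : secant l1 ->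
  all on_curve [:: A; B; C; D; E; G] ->
  all (on_line l1) [:: A; B; D] -> all (on_line l2) [:: A; C; E] ->
  all (on_line l3) [:: B; C; G] -> all (on_line l4) [:: D; E; G] ->
  [|| on_line l3 A, on_line l2 B, on_line l4 A, on_line l4 B | on_line l4 C].
Proof.
move=> sec1 /= /and5P[cA cB cC cD /and3P[cE cG _]] /and4P[A1 B1 D1 _].
move=> /and4P[A2 C2 E2 _] /and4P[B3 C3 G3 _] /and4P[D4 E4 G4 _].
apply: contraT; rewrite !negb_or -!L_eq0 => /and5P[A3 B2 A4 B4 C4].
have a12 : l1.1 != l2.1.
  by apply: contraNneq B2 => a12; rewrite L_eq0 (same_slope A1 A2).
have a23 : l2.1 != l3.1.
  by apply: contraNneq A3 => a23; rewrite L_eq0 (same_slope C2 C3).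
have xAB : A.1 != B.1.
  by apply: contraNneq A3 => /(line_inj A1 B1) ->; rewrite L_eq0.
have xAC : A.1 != C.1.
  by apply: contraNneq A3 => /(line_inj A2 C2) ->; rewrite L_eq0.
have xBC : B.1 != C.1.
  by apply: contraNneq B2 => /(line_inj B3 C3) ->; rewrite L_eq0.
have hAB := h_neq0 sec1 cA A1 B1 ltac:(by move=> AB; rewrite AB eqxx in xAB).
have tAB := transversal cA cB cD A1 B1 D1 D4.
have tAC := transversal cA cC cE A2 C2 E2 E4.
have tBC := transversal cB cC cG B3 C3 G3 G4.
set a := L l4 A in tAB tAC A4; set b := L l4 B in tAB tBC B4.
set c := L l4 C in tAC tBC C4.
have [sa0 sb0 sc0] : [/\ s a != 0, s b != 0 & s c != 0] by rewrite !s_eq0.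
(* Gram entries of A/a, B/b, C/c. By [transversal] this 3 by 3 matrix is alternating, with (r, t, p)
   in its kernel. *)
pose p := h A B / (a * s b); pose r := h B C / (b * s c); pose t := h C A / (c * s a).
have hA0 := h_diag cA; have hB0 := h_diag cB; have hC0 := h_diag cC.
have hBA : h B A = - p * (b * s a).
  apply: (mulfI (mulf_neq0 A4 sb0)); rewrite /p; move: tAB => /eqP.
  rewrite addrC addr_eq0 => /eqP tAB.
  have -> : a * s b * h B A = s b * a * h B A by ring.
  by rewrite tAB; field; rewrite A4 sb0.
have hAC : h A C = - t * (a * s c).
  apply: (mulfI (mulf_neq0 C4 sa0)); rewrite /t; move: tAC => /eqP.
  rewrite addr_eq0 => /eqP tAC.
  have -> : c * s a * h A C = c * s a * h A C by [].
  by rewrite tAC; field; rewrite C4 sa0.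
have hCB : h C B = - r * (c * s b).
  apply: (mulfI (mulf_neq0 B4 sc0)); rewrite /r; move: tBC => /eqP.
  rewrite addrC addr_eq0 => /eqP tBC.
  have -> : b * s c * h C B = s c * b * h C B by ring.
  by rewrite tBC; field; rewrite B4 sc0.
have hAB' : h A B = p * (a * s b) by rewrite /p; field; rewrite A4 sb0.
have hBC : h B C = r * (b * s c) by rewrite /r; field; rewrite B4 sc0.
have hCA : h C A = t * (c * s a) by rewrite /t; field; rewrite C4 sa0.
(* The vector v = r' A + t' B + p' C is orthogonal to A, B and C. It is shown to be zero, and
   independence of the three points then forces p = 0, against h A B != 0. *)
pose r' := r / a; pose t' := t / b; pose p' := p / c.
pose v1 := r' * A.1 + t' * B.1 + p' * C.1.
pose v2 := r' * A.2 + t' * B.2 + p' * C.2.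
pose v3 := r' + t' + p'.
have vE P : v1 * s P.1 - v2 - v3 * s P.2 = r' * h A P + t' * h B P + p' * h C P.
  by rewrite /v1 /v2 /v3 /h; ring.
have vA : v1 * s A.1 - v2 - v3 * s A.2 = 0.
  by rewrite vE hA0 hBA hCA /r' /t' /p'; field; rewrite A4 B4 C4.
have vB : v1 * s B.1 - v2 - v3 * s B.2 = 0.
  by rewrite vE hB0 hAB' hCB /r' /t' /p'; field; rewrite A4 B4 C4.
have vC : v1 * s C.1 - v2 - v3 * s C.2 = 0.
  by rewrite vE hC0 hAC hBC /r' /t' /p'; field; rewrite A4 B4 C4.
(* Orthogonality to two points of a line fixes v1 in terms of v3 and the slope; two different slopes
   give v3 = 0. *)
have dir l P Q : on_line l P -> on_line l Q -> P.1 != Q.1 ->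
    v1 * s P.1 - v2 - v3 * s P.2 = 0 -> v1 * s Q.1 - v2 - v3 * s Q.2 = 0 ->
    v1 = v3 * s l.1.
  move=> lP lQ PQ vP vQ; have := congr1 s (line_sub lP lQ).
  rewrite sM !sD !sN => slE; apply: (mulIf (_ : s P.1 - s Q.1 != 0)).
    by rewrite -sN -sD s_eq0 subr_eq0.
  rewrite -mulrA -slE; apply/eqP; rewrite -subr_eq0; apply/eqP.
  have -> : v1 * (s P.1 - s Q.1) - v3 * (s P.2 - s Q.2) =
    (v1 * s P.1 - v2 - v3 * s P.2) - (v1 * s Q.1 - v2 - v3 * s Q.2) by ring.
  by rewrite vP vQ subrr.
have d1 := dir _ _ _ A1 B1 xAB vA vB; have d2 := dir _ _ _ A2 C2 xAC vA vC.
have v30 : v3 = 0.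
  apply: (mulIf (_ : s l1.1 - s l2.1 != 0)).
    by rewrite -sN -sD s_eq0 subr_eq0.
  by rewrite mul0r mulrBr -d1 -d2 subrr.
have v10 : v1 = 0 by rewrite d1 v30 mul0r.
have v20 : v2 = 0 by move: vA; rewrite v10 v30 !mul0r sub0r subr0 => /eqP; rewrite oppr_eq0 => /eqP.
have rE : r' = - t' - p'.
  by apply/eqP; rewrite -subr_eq0; apply/eqP; rewrite -[RHS]v30 /v3; ring.
have x0 : r' * (A.1 - C.1) + t' * (B.1 - C.1) = 0.
  by rewrite -[RHS]v10 /v1 rE; ring.
have y0 : r' * (l2.1 * (A.1 - C.1)) + t' * (l3.1 * (B.1 - C.1)) = 0.
  by rewrite -(line_sub A2 C2) -(line_sub B3 C3) -[RHS]v20 /v2 rE; ring.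
have t0 : t' = 0.
  apply: (mulIf (_ : (l3.1 - l2.1) * (B.1 - C.1) != 0)).
    by rewrite mulf_neq0 ?subr_eq0 // eq_sym.
  rewrite mul0r; have -> : t' * ((l3.1 - l2.1) * (B.1 - C.1)) =
    r' * (l2.1 * (A.1 - C.1)) + t' * (l3.1 * (B.1 - C.1)) -
    l2.1 * (r' * (A.1 - C.1) + t' * (B.1 - C.1)) by ring.
  by rewrite x0 y0 mulr0 subr0.
have r0 : r' = 0.
  apply: (mulIf (_ : A.1 - C.1 != 0)); first by rewrite subr_eq0.
  by move: x0; rewrite t0 !mul0r addr0.
have p0 : p' = 0 by move: rE; rewrite r0 t0 oppr0 sub0r => /esym/eqP; rewrite oppr_eq0 => /eqP.
move/eqP: p0; rewrite mulf_eq0 invr_eq0 (negPf C4) orbF => /eqP p0.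
by move: hAB; rewrite hAB' p0 mul0r eqxx.
Qed.
End HermitianCurve.

(** * Counting points and secants over the field with q^2 elements *)

Section HermitianCurveCount.
Variables (F : finFieldType) (q : nat).
Hypotheses (q_gt1 : (1 < q)%N) (cardF : #|F| = (q ^ 2)%N).
Hypothesis pcharF : [pchar F].-nat q.
Let s (x : F) := x ^+ q.

Lemma expr_qD : {morph s : x y / x + y}.
Proof. by move=> x y; rewrite /s exprDn_pchar. Qed.

Lemma expr_qM : {morph s : x y / x * y}.
Proof. by move=> x y; rewrite /s exprMn. Qed.

Lemma expr_qK : involutive s.
Proof. by move=> x; rewrite /s -exprM mulnn -cardF expf_card. Qed.

Lemma card_expD_roots n (r : {poly F}) : (size r <= n)%N ->
  (#|[set x : F | (x ^+ n + r.[x] == 0)%R]| <= n)%N.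
Proof.
move=> rn; have szp : size ('X^n + r) = n.+1 by rewrite size_polyDl size_polyXn.
rewrite -ltnS -szp cardE; apply: max_poly_roots.
- by rewrite -size_poly_eq0 szp.
- by apply/allP => x; rewrite mem_enum inE rootE hornerD hornerXn.
- exact: enum_uniq.
Qed.

Let card_fst_fibers (X : {set F * F}) :
  (forall a, #|[set b | (a, b) \in X]| <= q)%N -> (#|X| <= q ^ 3)%N.
Proof.
move=> H; rewrite (@card_fibers _ _ fst X setT) // expnS mulnC -cardF.
rewrite -sum_nat_const (eq_bigl xpredT) => [|a]; last by rewrite inE.
apply: leq_sum => a _; apply: leq_trans (H a).
rewrite -(card_in_imset (f := snd)).
  apply/subset_leq_card/subsetP => _ /imsetP[[x y] + ->].
  by rewrite !inE /= => /andP[xy /eqP <-].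
move=> [x y] [x' y']; rewrite !inE /= => /andP[_ /eqP ->] /andP[_ /eqP ->].
by move=> ->.
Qed.

Lemma card_curve : (#|[set P | on_curve s P]| <= q ^ 3)%N.
Proof.
apply: card_fst_fibers => a.
apply: leq_trans (card_expD_roots (r := 'X - (a * s a)%:P) _); last first.
  by rewrite size_XsubC.
apply/subset_leq_card/subsetP => b; rewrite !inE /on_curve /= => /eqP ->.
by rewrite hornerXsubC -[b ^+ q]/(s b); apply/eqP; ring.
Qed.

Lemma card_nonsecant : (#|[set l | ~~ secant s l]| <= q ^ 3)%N.
Proof.
apply: card_fst_fibers => a.
apply: leq_trans (card_expD_roots (r := 'X - (- (a * s a))%:P) _); last first.
  by rewrite size_XsubC.
apply/subset_leq_card/subsetP => b; rewrite !inE /secant negbK /= => /eqP E.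
by rewrite hornerXsubC -[b ^+ q]/(s b); apply/eqP; rewrite -[RHS]E; ring.
Qed.

Lemma card_secant : (q ^ 4 <= #|[set l | secant s l]| + q ^ 3)%N.
Proof.
have <- : #|{: F * F}| = (q ^ 4)%N by rewrite card_prod cardF -expnD.
rewrite -(cardsC [set l | secant s l]) leq_add2l.
apply: leq_trans card_nonsecant; apply/subset_leq_card/subsetP => l.
by rewrite !inE.
Qed.

(* The q^2 - 1 nonzero elements are spread over at most q - 1 fibres of the
   norm, each of size at most q + 1, so every fibre has size q + 1. *)
Lemma card_norm_fiber T : T != 0 -> s T = T ->
  (q <= #|[set z | (z * s z == T)%R]|)%N.
Proof.
move=> T0 sT.
pose X := [set z : F | z != 0]; pose S := [set t : F | (t != 0) && (s t == t)].
pose N z := z * s z.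
have cX : (#|X|.+1 = q ^ 2)%N.
  rewrite -cardF -(cardC (pred1 (0 : F))) card1; congr _.+1.
  by apply: eq_card => z; rewrite !inE.
have cS : (#|S| < q)%N.
  apply: leq_trans (card_expD_roots (r := - 'X) _); last by rewrite size_polyN size_polyX.
  (* Zero is a further root of t^q - t, which makes the inequality strict. *)
  rewrite -[#|S|.+1]add1n -(_ : #|0 |: S| = (1 + #|S|)%N); last first.
    by rewrite cardsU1 inE eqxx.
  apply/subset_leq_card/subsetP => t; rewrite !inE hornerN hornerX subr_eq0.
  by case/orP => [/eqP->|/andP[_ //]]; rewrite expr0n; case: q q_gt1.
have TS : T \in S by rewrite inE T0 sT eqxx.
have NS : {in X, forall z, N z \in S}.
  move=> z; rewrite !inE /N => z0; rewrite mulf_neq0 ?expf_neq0 //=.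
  by rewrite expr_qM expr_qK mulrC.
have fib t : (#|[set z in X | N z == t]| <= q.+1)%N.
  apply: leq_trans (card_expD_roots (r := - t%:P) _); last first.
    by rewrite size_polyN (leq_trans (size_polyC_leq1 _)).
  apply/subset_leq_card/subsetP => z; rewrite !inE hornerN hornerC => /andP[_ /eqP <-].
  by rewrite /N /s -exprS subrr.
have := card_fibers NS; rewrite (bigD1 T) //=.
have : (\sum_(t in S | t != T) #|[set z in X | N z == t]| <= #|S|.-1 * q.+1)%N.
  apply: leq_trans (leq_sum _ (fun t _ => fib t)) _.
  rewrite sum_nat_const leq_mul2r; apply/orP; right.
  rewrite (cardsD1 T S) TS /=; apply/subset_leq_card/subsetP => t.
  by rewrite !inE unfold_in !inE andbC.
have : (#|[set z in X | N z == T]| <= #|[set z | (z * s z == T)%R]|)%N.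
  by apply/subset_leq_card/subsetP => z; rewrite !inE => /andP[].
move: cX cS; have : (0 < #|S|)%N by apply/card_gt0P; exists T.
move: (#|S|) (#|X|) (\sum_(_ in _ | _) _)%N => cs cx sm.
move: (#|[set z in X | N z == T]|) (#|[set z | (z * s z == T)%R]|) => u v.
case: cs => // cs _ cx1 cs1 uv sm1 E; simpl in sm1.
have := leq_mul (_ : (cs <= q - 2)%N) (leqnn q.+1); nia.
Qed.

(** The shift x = z + s a turns the intersection into a norm equation z s(z) = T with T nonzero and
    fixed by s. *)
Lemma card_secant_points l : secant s l ->
  (q <= #|[set P | on_curve s P && on_line l P]|)%N.
Proof.
case: l => a b sec.
have fixed : s (a * s a + b + s b) = a * s a + b + s b.
  by rewrite !(expr_qD, expr_qM) !expr_qK; ring.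
apply: leq_trans (card_norm_fiber sec fixed) _.
rewrite -(card_imset (f := fun z => (z + s a, a * (z + s a) + b))); last first.
  by move=> z z' [/addIr].
apply/subset_leq_card/subsetP => _ /imsetP[z + ->]; rewrite !inE => /eqP zT.
rewrite /on_curve /on_line /= eqxx andbT !(expr_qD, expr_qM) !expr_qK.
apply/eqP; have -> : (z + s a) * (s z + a) = z * s z + z * a + s a * s z + s a * a by ring.
by rewrite zT /=; ring.
Qed.
End HermitianCurveCount.

(** * Lower bound for the Ramsey number *)

Definition K4_free (T : finType) (e : rel T) :=
  forall x1 x2 x3 x4, ~~ [&& e x1 x2, e x1 x3, e x1 x4, e x2 x3, e x2 x4 & e x3 x4].

(** * The K_4-free graph on the secants *)

Section HermitianGraph.
Variables (F : finFieldType) (q : nat).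
Hypotheses (q_gt1 : (1 < q)%N) (cardF : #|F| = (q ^ 2)%N).
Hypothesis pcharF : [pchar F].-nat q.
Let s (x : F) := x ^+ q.
Let Pt := {P : F * F | on_curve s P}.
Let Ln := {l : F * F | secant s l}.
Let inc (l : Ln) (P : Pt) := on_line (val l) (val P).

Lemma hermitian_line_inj (l m : Ln) (p p' : Pt) :
  l != m -> inc l p -> inc m p -> inc l p' -> inc m p' -> p = p'.
Proof.
rewrite -(inj_eq val_inj) /inc /on_line.
case: l m p p' => [[a b] _] [[a' b'] _] [[x y] hp] [[x' y'] hp'] /=.
move=> lm /eqP y1 /eqP y2 /eqP y1' /eqP y2'; apply: val_inj => /=.
have E : (a - a') * (x - x') = 0.
  have -> : (a - a') * (x - x') =
    ((a * x + b) - (a' * x + b')) - ((a * x' + b) - (a' * x' + b')) by ring.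
  by rewrite -y1 -y2 -y1' -y2' !subrr.
move/eqP: E; rewrite mulf_eq0 !subr_eq0 => /orP[/eqP aa|/eqP xx].
  by move: lm y2; rewrite y1 aa => + /addrI bb; rewrite bb eqxx.
by rewrite y1 y1' xx.
Qed.

Lemma card_hermitian_points : (#|{: Pt}| <= q ^ 3)%N.
Proof.
rewrite card_sig; apply: leq_trans (card_curve q_gt1 cardF).
by apply: subset_leq_card; apply/subsetP => P; rewrite !inE.
Qed.

Lemma card_hermitian_lines : (q ^ 4 <= #|{: Ln}| + q ^ 3)%N.
Proof.
apply: leq_trans (card_secant q_gt1 cardF) _; rewrite leq_add2r card_sig.
by apply: subset_leq_card; apply/subsetP => P; rewrite !inE.
Qed.

Lemma card_hermitian_lines_le : (#|{: Ln}| <= q ^ 4)%N.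
Proof.
rewrite card_sig; apply: leq_trans (max_card _) _.
by rewrite card_prod cardF -expnD.
Qed.

Lemma card_hermitian_line (l : Ln) : (q <= #|[set p | inc l p]|)%N.
Proof.
apply: leq_trans (card_secant_points q_gt1 cardF pcharF (valP l)) _.
rewrite -(card_imset _ val_inj); apply: subset_leq_card; apply/subsetP => P.
rewrite inE => /andP[cP lP]; apply/imsetP; exists (exist _ P cP) => //.
by rewrite inE.
Qed.

(** Three concurrent lines are never pairwise adjacent, since they meet only at the common point and
    it has two sides; by [onan_free], four pairwise adjacent lines would include three concurrent
    ones. *)
Lemma hermitian_K4_free (f : {ffun Pt -> {ffun Ln -> bool}}) :
  K4_free (bicolored inc f).
Proof.
have neq l m : bicolored inc f l m -> l != m.
  by apply: contraTneq => ->; rewrite bicolored_irr.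
have conc l m n p : bicolored inc f l m -> bicolored inc f l n ->
    bicolored inc f m n -> inc l p -> inc m p -> inc n p -> False.
  move=> lm ln mn lp mp np.
  case/existsP: (lm) => A /and3P[lA mA]; case/existsP: (ln) => B /and3P[lB nB].
  case/existsP: (mn) => C /and3P[mC nC].
  rewrite (hermitian_line_inj (neq _ _ lm) lA mA lp mp).
  rewrite (hermitian_line_inj (neq _ _ ln) lB nB lp np).
  rewrite (hermitian_line_inj (neq _ _ mn) mC nC mp np).
  by case: (f p l) (f p m) (f p n) => [] [] [].
move=> l1 l2 l3 l4; apply/negP => /and5P[e12 e13 e14 e23 /andP[e24 e34]].
case/existsP: (e12) => A /and3P[A1 A2 _]; case/existsP: (e13) => B /and3P[B1 B3 _].
case/existsP: (e23) => C /and3P[C2 C3 _]; case/existsP: (e14) => D /and3P[D1 D4 _].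
case/existsP: (e24) => E /and3P[E2 E4 _]; case/existsP: (e34) => G /and3P[G3 G4 _].
have := @onan_free F s (expr_qD pcharF) (@expr_qM _ _) (expr_qK cardF)
  (val l1) (val l2) (val l3) (val l4) (val A) (val B) (val C) (val D) (val E) (val G).
rewrite /= !(valP _) => H.
case/or4P: (H isT isT (introT and4P (And4 A1 B1 D1 isT)) (introT and4P (And4 A2 C2 E2 isT))
  (introT and4P (And4 B3 C3 G3 isT)) (introT and4P (And4 D4 E4 G4 isT))) => [h|h|h|/orP[h|h]].
- exact: (conc l1 l2 l3 A).
- exact: (conc l1 l2 l3 B).
- exact: (conc l1 l2 l4 A).
- exact: (conc l1 l3 l4 B).
- exact: (conc l2 l3 l4 C).
Qed.

Lemma exists_dense_K4_free (R : realFieldType) q' :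
  (0 < q')%N -> q = (8 * q')%N -> (4 * q ^ 4 <= 4 ^ q')%N ->
  exists (T : finType) (e : rel T),
    [/\ symmetric e, irreflexive e, K4_free e, (q ^ 4 - q ^ 3 <= #|T| <= q ^ 4)%N &
    forall U : {set T}, (8 * q ^ 2 < #|U|)%N -> exists2 u, u \in U &
      (64 * q)%:R^-1 * #|U|%:R <= #|[set z in U | e u z]|%:R :> R].
Proof.
move=> q'0 qE q'big.
have card_Ln : (4 * #|{: Ln}| <= 4 ^ q')%N.
  by apply: leq_trans q'big; rewrite leq_mul2l card_hermitian_lines_le.
have := @bicolored_dense Pt Ln inc q' q'0; rewrite -qE.
move=> /(_ card_hermitian_line card_hermitian_points card_Ln).
move=> /(_ hermitian_line_inj R) [f dense].
exists Ln, (bicolored inc f); split => //.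
- exact: bicolored_sym.
- exact: bicolored_irr.
- exact: hermitian_K4_free.
- by rewrite card_hermitian_lines_le andbT leq_subLR addnC card_hermitian_lines.
Qed.
End HermitianGraph.

Lemma bernoulli (R : realFieldType) (x : R) n : 0 <= x -> 1 + n%:R * x <= (1 + x) ^+ n.
Proof.
move=> x0; elim: n => [|n IH]; first by rewrite expr0; lra.
rewrite exprS -natr1; have : 0 <= n%:R * x * x by rewrite !mulr_ge0.
have := ler_wpM2l (_ : 0 <= 1 + x) IH; nra.
Qed.

(** Multiply by (1 + 1/m)^m, which is at least 2 by Bernoulli; the product is at most 1. *)
Lemma one_sub_inv_expr (R : realFieldType) m : (0 < m)%N -> (1 - m%:R^-1) ^+ m <= 2^-1 :> R.
Proof.
move=> m0; have mR : 0 < m%:R :> R by rewrite ltr0n.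
have x0 : 0 <= m%:R^-1 :> R by rewrite invr_ge0 ltW.
have x1 : m%:R^-1 <= 1 :> R by rewrite invf_le1 // ler1n.
have := bernoulli m x0; rewrite mulfV ?gt_eqF // => B.
have P : (1 - m%:R^-1) ^+ m * (1 + m%:R^-1) ^+ m <= 1 :> R.
  by rewrite -exprMn exprn_ile1 //; nra.
have : 0 <= (1 - m%:R^-1) ^+ m :> R by rewrite exprn_ge0 //; lra.
nra.
Qed.

Lemma one_add_inv_expr (R : realFieldType) m : (0 < m)%N ->
  (1 + (m.*2)%:R^-1) ^+ m.*2 <= 4 :> R.
Proof.
move=> m0; have mR : 0 < m%:R :> R by rewrite ltr0n.
have x0 : 0 <= (m.*2)%:R^-1 :> R by rewrite invr_ge0.
have : 2 * m%:R * (m.*2)%:R^-1 = 1 :> R by rewrite -mul2n natrM; field; lra.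
move=> E; have H : (1 + (m.*2)%:R^-1) ^+ m <= 1 + 1 :> R.
  by apply: le_trans (expr1D_le x0 _) _; rewrite E.
rewrite -{2}muln2 exprM (_ : 4 = (1 + 1) ^+ 2); last by ring.
by apply: lerXn2r; rewrite ?nnegrE ?exprn_ge0 //; lra.
Qed.

(* Kleitman-Winston with x = 1/q: after 128 q k halving steps at most 8 q^2
   vertices are left, so there are at most (4 q)^t independent t-sets. *)
Lemma exists_sparse_subset (R : realFieldType) k (q := (2 ^ k)%N) (T : finType) (e : rel T) :
  (1 < k)%N ->
  (q ^ 4 - q ^ 3 <= #|T| <= q ^ 4)%N ->
  (forall U : {set T}, (8 * q ^ 2 < #|U|)%N -> exists2 u, u \in U &
      (64 * q)%:R^-1 * #|U|%:R <= #|[set z in U | e u z]|%:R :> R) ->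
  exists2 W : {set T}, #|W| = (2 ^ (3 * k - 4))%N &
    forall I : {set T}, I \subset W -> independent e I ->
      #|I| != (512 * 2 ^ k * k ^ 2)%N.
Proof.
move=> k1 /andP[Mge Mle] dense; set t := (512 * _ * _)%N.
have k0 : (0 < k)%N by apply: ltnW.
have q0 : (0 < q)%N by rewrite expn_gt0.
have q1 : (1 < q)%N by rewrite -[1%N](expn0 2) ltn_exp2l.
have t0 : (0 < t)%N by rewrite /t -/q; nia.
have qR : 0 < q%:R :> R by rewrite ltr0n.
have q1R : 1 <= q%:R :> R by rewrite ler1n.
have q2R : 2 <= q%:R :> R by rewrite (ler_nat R 2).
pose x : R := q%:R^-1.
have x0 : 0 <= x by rewrite invr_ge0 ltW.
pose j := (128 * q * k)%N.
have beta01 : 0 <= ((64 * q)%:R^-1 : R) <= 1.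
  have m0 : (0 < 64 * q)%N by rewrite muln_gt0.
  apply/andP; split; first by rewrite invr_ge0.
  by rewrite invf_le1 ?ler1n ?ltr0n.
have small : #|[set: T]|%:R * (1 - (64 * q)%:R^-1) ^+ j <= (8 * q ^ 2)%:R :> R.
  (* Every 64 q steps halve the set, and 2k halvings take q^4 to q^2. *)
  have -> : j = (64 * q * (2 * k))%N by rewrite /j; lia.
  rewrite exprM; apply: (@le_trans _ _ ((q ^ 4)%:R * (2^-1 ^+ (2 * k)))).
    apply: ler_pM; rewrite ?ler0n //.
    - by rewrite !exprn_ge0 //; lra.
    - by rewrite ler_nat cardsT.
    - apply: lerXn2r; rewrite ?nnegrE; [by rewrite exprn_ge0 //; lra|lra|].
      by apply: one_sub_inv_expr; rewrite muln_gt0.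
  rewrite [(2 * k)%N]mulnC exprVn exprM -natrX -/q ler_pdivrMr ?exprn_gt0 //.
  rewrite -natrX -!natrM ler_nat; nia.
have := indpoly_bound x0 beta01 dense small.
have step1 : (1 + x) ^+ (8 * q ^ 2) <= 2 ^+ t.
  have qh : q = (2 ^ k.-1).*2 by rewrite /q -mul2n -expnS prednK.
  have := one_add_inv_expr R (_ : 0 < 2 ^ k.-1)%N; rewrite -qh -/x expn_gt0 => /(_ isT) H.
  have -> : (8 * q ^ 2 = q * (8 * q))%N by rewrite -mulnn mulnCA.
  rewrite exprM; apply: (@le_trans _ _ (4 ^+ (8 * q))).
    by apply: lerXn2r; rewrite ?nnegrE ?exprn_ge0 //; lra.
  rewrite (_ : 4 = 2 ^+ 2); last by ring.
  rewrite -exprM; apply: ler_weXn2l; first by lra.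
  by rewrite /t -/q; clear -k0; nia.
(* The base is at most 1 + q^3 <= 2^(4k), and 4 k j = 512 q k^2: this dictates t. *)
have step2 : (1 + x * #|T|%:R) ^+ j <= 2 ^+ t.
  have H : 1 + x * #|T|%:R <= 2 ^+ (4 * k).
    rewrite [(4 * k)%N]mulnC exprM -natrX -/q; apply: (@le_trans _ _ (1 + x * q%:R ^+ 4)).
      by rewrite lerD2l; apply: ler_wpM2l => //; rewrite -natrX ler_nat.
    have -> : x * q%:R ^+ 4 = q%:R ^+ 3 by rewrite /x; field; lra.
    have := exprn_ege1 3 q1R; rewrite [q%:R ^+ 4]exprS; set y := _ ^+ 3; nra.
  apply: (@le_trans _ _ ((2 ^+ (4 * k)) ^+ j)).
    apply: lerXn2r; rewrite ?nnegrE ?exprn_ge0 ?addr_ge0 ?mulr_ge0 //.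
  by rewrite -exprM /t /j -/q (_ : 4 * k * _ = 512 * q * k ^ 2)%N //; clear; lia.
move=> Z; have {}Z : indpoly e x [set: T] <= 4 ^+ t.
  apply: le_trans Z _; rewrite (_ : 4 = 2 * 2) ?exprMn; last by ring.
  by apply: ler_pM => //; rewrite exprn_ge0 ?addr_ge0 ?mulr_ge0.
have := le_trans (card_independent_le_indpoly e x0 t) Z.
rewrite /x exprVn ler_pdivrMr ?exprn_gt0 // -exprMn -natrM -natrX ler_nat => few.
(* The ratio 8q beats the count (4q)^t, and 8q (q^3/16) = q^4/2 <= q^4 - q^3. *)
apply: (@exists_subset_no_independent _ e (8 * q)) => //.
- by rewrite muln_gt0.
- apply: leq_trans Mge.
  have q3 : (q ^ 3 = 16 * 2 ^ (3 * k - 4))%N.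
    by rewrite -expnM mulnC -(expnD 2 4) subnKC //; clear -k1; lia.
  by rewrite [(q ^ 4)%N]expnS q3; clear -q1; nia.
- by apply: leq_ltn_trans few _; rewrite ltn_exp2r //; clear -q0; lia.
Qed.

Lemma exists_K4_free_graph k : (8 <= k)%N ->
  exists (T : finType) (e : rel T) (W : {set T}),
    [/\ symmetric e /\ irreflexive e, K4_free e, #|W| = (2 ^ (3 * k - 4))%N &
    forall I : {set T}, I \subset W -> independent e I ->
      #|I| != (512 * 2 ^ k * k ^ 2)%N].
Proof.
move=> k8; pose q := (2 ^ k)%N; pose q' := (2 ^ (k - 3))%N.
have qE : q = (8 * q')%N by rewrite /q /q' -(expnD 2 3) subnKC //; lia.
have q'0 : (0 < q')%N by rewrite expn_gt0.
have q1 : (1 < q)%N by lia.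
have [F pcF cF] := @PrimePowerField 2 (2 * k) isT ltac:(lia).
have cardF : #|F| = (q ^ 2)%N by rewrite cF /q -expnM mulnC.
have pcharF : [pchar F].-nat q.
  by rewrite /q pnatX; apply/orP; left; rewrite pnatE.
(* The base-2 logarithm of 4 q^4 <= 4^(q/8), the size condition for the random bipartition. *)
have kq : (4 * k + 2 <= 2 ^ (k - 2))%N.
  rewrite -(subnKC k8); elim: (k - 8)%N => // i IH.
  rewrite (_ : (8 + i.+1 - 2 = (8 + i - 2).+1)%N); last by lia.
  by rewrite expnS; lia.
have q'big : (4 * q ^ 4 <= 4 ^ q')%N.
  rewrite /q -expnM (_ : 4 = 2 ^ 2)%N // -expnD -expnM leq_exp2l //.
  by rewrite /q' -expnS; move: kq; rewrite (_ : (k - 3).+1 = k - 2)%N; lia.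
have [T [e [e_sym e_irr K4 cT dense]]] :=
  exists_dense_K4_free q1 cardF pcharF rat q'0 qE q'big.
have k1 : (1 < k)%N by apply: leq_trans k8.
have [W cW HW] := exists_sparse_subset k1 cT dense.
by exists T, e, W.
Qed.

Local Close Scope ring_scope.

(** If r <= |W|, embed the r vertices in W and colour the edges of e red: a red K_4 is excluded, and
    a red-independent n-set would contain an independent t-set. *)
Lemma ramsey4_lower (T : finType) (e : rel T) (W : {set T}) t n :
  symmetric e -> irreflexive e -> K4_free e ->
  (forall I : {set T}, I \subset W -> independent e I -> #|I| != t) ->
  t <= n -> #|W| < ramsey 4 n.
Proof.
move=> e_sym e_irr K4 alpha tn; rewrite /ramsey; case: ex_minnP => r rP _.
rewrite ltnNge; apply/negP => rW.
pose g (i : 'I_r) := enum_val (widen_ord rW i).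
have gW i : g i \in W by apply: enum_valP.
have g_inj : injective g.
  by move=> i i' /enum_val_inj /(congr1 val) /= /val_inj.
pose c : coloring r := [ffun X : {set 'I_r} =>
  [forall i in X, forall i' in X, ~~ e (g i) (g i')]].
have redc i i' : red c i i' = e (g i) (g i').
  rewrite /red ffunE; have [->|ii'] := eqVneq i i'; first by rewrite e_irr.
  apply/idP/idP => /= [|ee].
    rewrite negb_forall_in => /exists_inP[x xX].
    rewrite negb_forall_in => /exists_inP[y yX]; rewrite negbK.
    by move: xX yX; rewrite !inE => /orP[]/eqP-> /orP[]/eqP->; rewrite ?e_irr // e_sym.
  rewrite negb_forall_in; apply/exists_inP; exists i; first by rewrite !inE eqxx.
  rewrite negb_forall_in; apply/exists_inP; exists i'; rewrite ?negbK //.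
  by rewrite !inE eqxx orbT.
have /orP[] := forallP rP c => /existsP[X /andP[/eqP cX iX]].
  have [x1 [x2 [x3 [x4 [U sX]]]]] : exists x1 x2 x3 x4, uniq [:: x1; x2; x3; x4] /\
      {subset [:: x1; x2; x3; x4] <= X}.
    have := enum_uniq X; have := @mem_enum _ X; rewrite cardE in cX.
    case: (enum X) cX => [|x1 [|x2 [|x3 [|x4 []]]]] // _ me U.
    by exists x1, x2, x3, x4; split=> // x; rewrite me.
  have red_in x y : x \in X -> y \in X -> x != y -> e (g x) (g y).
    move=> xX yX xy; rewrite -redc redE xy; exact: (independentP _ _ iX).
  have [y1 y2 y3 y4] : [/\ x1 \in X, x2 \in X, x3 \in X & x4 \in X].
    by split; apply: sX; rewrite !inE eqxx ?orbT.
  move: U => /= /and4P[]; rewrite !inE !negb_or => /and3P[? ? ?] /andP[? ?] ? _.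
  by have := K4 (g x1) (g x2) (g x3) (g x4); rewrite !red_in.
have iY : independent e (g @: X).
  apply/independentP => _ _ /imsetP[x xX ->] /imsetP[y yX ->]; rewrite -redc.
  exact: (independentP _ _ iX).
have := tn; rewrite -cX -(card_imset _ g_inj) => /(independent_subset_card iY)[Y [YX cY {}iY]].
have YW : Y \subset W.
  by apply: subset_trans YX _; apply/subsetP => _ /imsetP[x _ ->].
by have := alpha Y YW iY; rewrite cY eqxx.
Qed.

(** Take k = 24 j. The factor k^2 is at most 2^(10 + 2j), so t <= 2^(9 + 24j + 10 + 2j). *)
Lemma ramsey4_lower_pow j n : 0 < j -> 2 ^ (19 + 26 * j) <= n ->
  2 ^ (72 * j - 4) < ramsey 4 n.
Proof.
move=> j0 jn; have k8 : 8 <= 24 * j by lia.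
have [T [e [W [[es ei] K4 cW alpha]]]] := exists_K4_free_graph k8.
have -> : 72 * j = 3 * (24 * j) by lia.
rewrite -cW; apply: (ramsey4_lower es ei K4 alpha); apply: leq_trans jn.
have -> : 512 = 2 ^ 9 by [].
have j2 : (24 * j) ^ 2 <= 2 ^ 10 * 2 ^ (2 * j).
  rewrite [2 * j]mulnC expnM expnMn leq_mul // leq_sqr.
  exact/ltnW/ltn_expl.
apply: leq_trans (leq_mul (leqnn _) j2) _.
by rewrite -!expnD leq_exp2l //; lia.
Qed.

(** Choose j with 2^(19 + 26j) <= n <= 2^(45 + 26j), so that j >= J. The upper bound is 2^(124 +
    70j), the lower one 2^(72j - 4), and their quotient is 2^128 / 4^j. *)
Lemma mixed_ramsey4_le_ramsey J n : 0 < J -> 2 ^ (19 + 26 * J) <= n ->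
  mixed_ramsey 4 n * 4 ^ J <= 2 ^ 128 * ramsey 4 n.
Proof.
move=> J0 Jn; pose l := trunc_log 2 n; pose j := (l - 19) %/ 26.
have n0 : 0 < n by apply: leq_trans Jn; rewrite expn_gt0.
have Jl : 19 + 26 * J <= l by apply: trunc_log_max.
have Jj : J <= j by rewrite /j; lia.
have lj : 19 + 26 * j <= l < 45 + 26 * j by rewrite /j; lia.
have jn : 2 ^ (19 + 26 * j) <= n.
  apply: leq_trans (trunc_logP (isT : 1 < 2) n0); rewrite leq_exp2l //.
  by case/andP: lj.
have nj : n <= 2 ^ (45 + 26 * j).
  apply: leq_trans (ltnW (trunc_log_ltn n (isT : 1 < 2))) _; rewrite leq_exp2l //.
  by case/andP: lj.
have j0 : 0 < j by apply: leq_trans Jj.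
have low := ramsey4_lower_pow j0 jn.
pose h := 2 ^ (15 + 9 * j).
have nh : n <= h ^ 3.
  by apply: leq_trans nj _; rewrite /h -expnM leq_exp2l //; lia.
have up := mixed_ramsey4_upper nh.
have {}up : mixed_ramsey 4 n <= 2 ^ (124 + 70 * j).
  apply: leq_trans up _; apply: (@leq_trans (2 ^ 4 * (n ^ 2 * h ^ 2))).
    have h0 : 0 < h by rewrite expn_gt0.
    by move: h h0 {nh} => h h0; clear -n0 h0; nia.
  rewrite (_ : 124 + 70 * j = 4 + ((45 + 26 * j) * 2 + (15 + 9 * j) * 2)); last by lia.
  rewrite (expnD _ 4) expnD !expnM; apply: leq_mul; first exact: leqnn.
  by apply: leq_mul; rewrite leq_sqr.
apply: (@leq_trans (2 ^ 128 * 2 ^ (72 * j - 4))); last first.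
  by apply: leq_mul; [exact: leqnn|exact: ltnW].
apply: leq_trans (leq_mul up (leqnn _)) _.
have -> : 4 ^ J = 2 ^ (2 * J) by rewrite expnM.
rewrite -!expnD leq_exp2l //; clear -Jj j0; lia.
Qed.

(* Passage to the limit *)
From mathcomp Require Import all_classical all_reals all_analysis.
Import Order.TTheory GRing.Theory Num.Theory.
Import numFieldNormedType.Exports.
Local Open Scope classical_set_scope.
Local Open Scope ring_scope.

Theorem theorem1p2 (R : realType) :
  ((mixed_ramsey 4 n)%:R / (ramsey 4 n)%:R : R) @[n --> \oo] --> (0 : R).
Proof.
apply/cvgrPdist_lt => eps eps0.
set c : R := (2 ^ 128)%:R; have c0 : 0 < c by rewrite ltr0n expn_gt0.
(* The ratio is at most c / 4^(J+1) for large n, and J <= 4^(J+1); the successor keeps the exponent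
   positive. *)
have [J Jlt] : exists J, c / eps < J%:R.
  by exists (Num.bound (c / eps)); apply: archi_boundP; rewrite divr_ge0 ?ltW.
exists (2 ^ (19 + 26 * J.+1))%N => // n /= Jn.
rewrite sub0r normrN ger0_norm ?divr_ge0 //.
have le := mixed_ramsey4_le_ramsey (isT : (0 < J.+1)%N) Jn.
have r0 : (0 < ramsey 4 n)%N.
  apply: leq_ltn_trans (ramsey4_lower_pow (isT : (0 < J.+1)%N) Jn); exact: leq0n.
rewrite ltr_pdivrMr ?ltr0n //.
have J0 : 0 < (4 ^ J.+1)%:R :> R by rewrite ltr0n expn_gt0.
rewrite -(ltr_pM2r J0) -natrM.
apply: (@le_lt_trans _ _ (c * (ramsey 4 n)%:R)).
  by rewrite /c -natrM ler_nat.
rewrite mulrAC ltr_pM2r ?ltr0n // mulrC -ltr_pdivrMr //.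
apply: lt_le_trans Jlt _; rewrite ler_nat.
by apply: leq_trans (ltnW (ltn_expl J (isT : 1 < 4)%N)) _; rewrite leq_exp2l.
Qed.
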